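(* Let $E \subset [0,1]^3$ with $\dim_{\mathcal H}(E) > \frac{13}{5}$. Then $\mathcal{L}^1(\mathcal{V}(E)) > 0$.
   Context: $\dim_{\mathcal H}$ denotes Hausdorff dimension and $\mathcal{L}^1$ denotes one-dimensional Lebesgue measure on $\mathbb{R}$. For $E \subset [0,1]^3$, the volume set of $E$ is $\mathcal{V}(E) = \{\det(x^1,x^2,x^3) \in \mathbb{R} : x^1,x^2,x^3 \in E\}$, where $\det(x^1,x^2,x^3)$ is the determinant of the $3\times 3$ matrix whose $j$th column is $x^j$.
   Formalization: E is assumed to be a Borel set: for arbitrary E in [0,1]^3 the set V(E) may fail to be Lebesgue measurable, and under the continuum hypothesis E = K^3 ∩ [0,1]^3, with K a subfield of the reals of dimension in (13/15, 1), is a counterexample. *)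

(* Defs.v *)
From mathcomp Require Import all_boot all_order all_algebra.
From mathcomp Require Import all_classical all_reals all_analysis.

Set Implicit Arguments.
Unset Strict Implicit.
Unset Printing Implicit Defensive.

Import Order.TTheory GRing.Theory Num.Theory.
Import numFieldNormedType.Exports.

Local Open Scope classical_set_scope.
Local Open Scope ring_scope.

(* The library norm on 'cV[R]_n is the sup norm, so the Euclidean distance is
   spelled out.  Both induce the library topology on 'cV[R]_n. *)
Definition eucl_dist (R : realType) (n : nat) (x y : 'cV[R]_n) : R :=
  Num.sqrt (\sum_(i < n) (x i 0 - y i 0) ^+ 2).

(* This is -oo on the empty set; see [diam_pow]. *)
Definition diam (R : realType) (n : nat) (U : set 'cV[R]_n) : \bar R :=
  ereal_sup [set (eucl_dist x y)%:E | x in U & y in U].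

(* |U|^s, with the conventions |set0|^s = 0 for all s (including s = 0) and
   |U|^0 = 1 for nonempty U, so that the 0-dimensional Hausdorff measure is the
   counting measure. *)
Definition diam_pow (R : realType) (n : nat) (s : R) (U : set 'cV[R]_n) :
    \bar R :=
  if U == set0 then 0%E else poweR (diam U) s.

Definition hausdorff_premeasure (R : realType) (n : nat) (s delta : R)
    (E : set 'cV[R]_n) : \bar R :=
  ereal_inf [set (\sum_(0 <= k <oo) diam_pow s (U k))%E | U in
    [set U : nat -> set 'cV[R]_n |
      (forall k, (diam (U k) <= delta%:E)%E) /\ E `<=` \bigcup_k U k]].

Definition hausdorff_measure (R : realType) (n : nat) (s : R)
    (E : set 'cV[R]_n) : \bar R :=
  ereal_sup [set hausdorff_premeasure s delta E | delta in [set d : R | 0 < d]].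

Definition hausdorff_dim (R : realType) (n : nat) (E : set 'cV[R]_n) : \bar R :=
  ereal_inf [set s%:E | s in
    [set s : R | 0 <= s /\ hausdorff_measure s E = 0%E]].

Definition borel_set (T : topologicalType) (A : set T) : Prop :=
  <<s (@open T) >> A.

Definition unit_cube (R : realType) (n : nat) : set 'cV[R]_n :=
  [set x | forall i, 0 <= x i 0 <= 1].

Definition volume_set (R : realType) (E : set 'cV[R]_3) : set R :=
  [set \det (\matrix_(i < 3, j < 3) x j i 0) | x in
    [set x : 'I_3 -> 'cV[R]_3 | forall j, E (x j)]].

(* Main.v *)
Require Import Defs.
From mathcomp Require Import all_boot all_order all_algebra.
From mathcomp Require Import all_classical all_reals all_analysis.
From mathcomp Require Import measurable_realfun.
From mathcomp Require Import ring lra.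

Import Order.TTheory GRing.Theory Num.Theory.
Import numFieldNormedType.Exports.

Local Open Scope classical_set_scope.
Local Open Scope ring_scope.

Set Implicit Arguments.
Unset Strict Implicit.
Unset Printing Implicit Defensive.

(** Fix [x1] in [E] with third coordinate [Z1 <> 0] and let [(a, b)] be the image of
    a point under the projection along [x1] onto the first two coordinates.  Then
    [det (x1, x2, x3) = Z1 * (a2 * b3 - b2 * a3)], so that with the slope
    [th = b2 / a2] the volumes are the values of [Z1 * a2 * (b - th * a)] on [E].
    It suffices to find [x1] and [x2] in [E] for which the linear form
    [b - th * a] spreads [E] over a set of positive length.

    Let [E] carry a mass that is at most [r^s] on balls of radius [r], with
    [s = 13/5].  A tube of width [r] is covered by [1/r] balls, so the planar points
    [(a, b)] have dimension [s - 1 = 8/5] ([tube_mass]); a slab of width [r] is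
    covered by [1/r^2] balls, so the slopes [th] have dimension [s - 2 = 3/5]
    ([slab_mass]).  These two dimensions add up to more than 2, and this makes the
    image of the mass under [b - th * a] square integrable for most slopes, with a
    bound independent of the resolution ([planar_energy_bound]).

    The square norm at resolution [d] is measured by the energy
    [sum w_i w_j k_d (u_i - u_j)] with [u_i = b_i - th * a_i] and
    [k_d u = 2 d^3 / (d^2 + u^2)^2].  Three properties of these kernels replace
    Fourier analysis.
    - [k_d - k_e] is positive definite for [d <= e] ([kern_form_antitone]): refining
      the resolution only increases the energy.
    - [k_d u] changes by a factor close to 1 when [u] moves by much less than [d]
      ([kern_harnack]): the sum over the given slopes can be replaced by Lebesgue
      measure on short intervals of slopes, at a cost governed by the dimension of
      the slopes.
    - [u * atan (u / d)] is a second primitive of [k_d]: the Lebesgue average over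
      the slope of the increment [k_d - k_(Ld)] at [b - th * a] is explicit and at
      most a multiple of [d / (d^2 + a^2 + b^2)] ([second_antiderivative]).  Its
      double sum over the points is controlled by their dimension.
    At resolution [32^(-3j)], with intervals of slopes of length [32^(-4j)], the
    increment of the average energy is of order [2^(-j)] ([energy_step]), so the
    energies stay bounded.  Bounded energy at resolution [d] means that the
    determinants meet at least [c / d] intervals of length [d] ([occupied_cells]).

    To apply this to [E], consider coverings by cells of side [32^(-n)] and weight
    [32^(-ns) = 2^(-13n)].  The content of [E], the least weight of a covering, is
    positive ([hausdorff_content]).  At each depth a set carries
    finitely many point masses with the required ball bound and with total mass its
    content ([frostman]), hence for every [e] the [e]-neighbourhood of the volume set
    of a set of content at least [c0] has measure at least some [c > 0] depending
    on [c0] alone ([volume_neighbourhood]).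

    It remains to let [e] tend to 0, which needs compactness.  The Borel set [E] is a
    Suslin set ([borel_suslin]): it is the projection of a closed set of pairs of a
    point and a sequence of integers.  As the content is continuous along increasing
    unions ([content_increasing]), the entries of these sequences can be bounded one
    after the other while the content stays above half of that of [E].  The
    neighbourhoods of the volume sets of the parts so obtained decrease, their
    measures are bounded below, and by compactness their intersection lies in the
    volume set of [E] ([vol_nbhd_limit]). *)

(** Settles the nonnegativity of expressions built from nonnegative atoms. *)
Ltac pos := rewrite ?nnegrE ?posrE; repeat first
  [ assumption | apply: ltW; assumption
  | lazymatch goal with
    | |- is_true (0 <= _ ^+ 2) => exact: sqr_ge0
    | |- is_true (0 <= `|_|) => exact: normr_ge0
    | |- is_true (0 <= expR _) => exact: expR_ge0
    | |- is_true (0 <= _%:R) => exact: ler0n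
    | |- is_true (0 <= _ ^+ _) => apply: exprn_ge0
    | |- is_true (0 <= _^-1) => rewrite invr_ge0
    | |- is_true (0 <= _ * _) => apply: mulr_ge0
    | |- is_true (0 <= _ + _) => apply: addr_ge0
    end | done ].

(** * Calculus *)

Section Calculus.
Variable R : realType.

Lemma is_derive_bigsum (I : finType) (f : I -> R -> R) (f' : I -> R) (t : R) :
  (forall i, is_derive t 1 (f i) (f' i)) ->
  is_derive t 1 (fun s => \sum_i f i s) (\sum_i f' i).
Proof.
move=> df; rewrite (_ : (fun s => _) = \sum_i f i); last first.
  by apply/funext => s; rewrite fct_sumE.
elim/big_ind2 : _ => // [|g g' h h' dg dh]; first exact: is_derive_cst.
exact: is_deriveD.
Qed.

Lemma is_deriveMl (f : R -> R) (c f' t : R) :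
  is_derive t 1 f f' -> is_derive t 1 (fun s => c * f s) (c * f').
Proof. by move=> df; apply: (@is_deriveZ _ _ _ f c t 1 f'). Qed.

Lemma mean_value (f f' : R -> R) (a b : R) : a < b ->
  (forall x : R, is_derive x 1 f (f' x)) ->
  exists2 c, a < c < b & f b - f a = f' c * (b - a).
Proof.
move=> ab df; have fc : {within `[a, b], continuous f}.
  apply: continuous_subspaceT => x; apply/differentiable_continuous/derivable1_diffP.
  exact: (@ex_derive _ _ _ _ _ _ _ (df x)).
have [c] := MVT ab (fun x _ => df x) fc.
by rewrite in_itv/= => ? ?; exists c.
Qed.

End Calculus.

(** * The kernels *)

Section Kernel.
Variable R : realType.
Implicit Types (d e u v h t : R).

(** The square of the Poisson kernel of the half plane, normalized so that its
    integral does not depend on [d]. *)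
Definition kern d u : R := 2 * d ^+ 3 / (d ^+ 2 + u ^+ 2) ^+ 2.

Lemma sqD_gt0 d u : 0 < d -> 0 < d ^+ 2 + u ^+ 2.
Proof. by move=> d0; rewrite ltr_wpDr ?sqr_ge0 ?exprn_gt0. Qed.

Lemma kern_ge0 d u : 0 < d -> 0 <= kern d u.
Proof.
move=> d0; apply: divr_ge0; last exact: sqr_ge0.
by rewrite mulr_ge0// exprn_ge0// ltW.
Qed.

Lemma kern_le d u : 0 < d -> kern d u <= 2 / d.
Proof.
move=> d0; have q0 := sqD_gt0 u d0.
rewrite /kern ler_pdivrMr ?exprn_gt0//.
rewrite mulrAC ler_pdivlMr// -subr_ge0.
have -> : 2 * (d ^+ 2 + u ^+ 2) ^+ 2 - 2 * d ^+ 3 * d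
  = 2 * (u ^+ 2 * (2 * d ^+ 2 + u ^+ 2)) by ring.
by pos.
Qed.

Lemma kern_near d u : 0 < d -> `|u| <= d -> (2 * d)^-1 <= kern d u.
Proof.
move=> d0 ud; have q0 := sqD_gt0 u d0.
have u2 : u ^+ 2 <= d ^+ 2.
  by rewrite -(real_normK (num_real u)) lerXn2r ?nnegrE//; pos.
rewrite /kern ler_pdivlMr ?exprn_gt0// mulrC ler_pdivrMr ?mulr_gt0//.
rewrite (_ : 2 * d ^+ 3 * (2 * d) = (2 * d ^+ 2) ^+ 2); last by ring.
rewrite lerXn2r ?nnegrE ?(ltW q0)//; first by pos.
by rewrite mulrDl mul1r lerD2l.
Qed.

(** [d^2 + v^2 <= (1 + h)^2 (d^2 + u^2)], since [|v| <= |u| + h d]. *)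
Lemma kern_harnack d h u v : 0 < d -> 0 <= h -> `|u - v| <= h * d ->
  kern d u <= (1 + h) ^+ 8 * kern d v.
Proof.
move=> d0 h0 uv; have q0 := sqD_gt0 u d0; have q0' := sqD_gt0 v d0.
have H : d ^+ 2 + v ^+ 2 <= (1 + h) ^+ 2 * (d ^+ 2 + u ^+ 2).
  have : `|v| <= `|u| + h * d.
    by rewrite -lerBlDl; apply: le_trans (lerB_dist _ _) _; rewrite distrC.
  rewrite -(real_normK (num_real v)) -(real_normK (num_real u)).
  have := normr_ge0 v; have := normr_ge0 u.
  move: `|u| `|v| => x y x0 y0 xy.
  have : y ^+ 2 <= (x + h * d) ^+ 2 by rewrite lerXn2r ?nnegrE//; pos.
  have : 0 <= h * (d - x) ^+ 2 by pos.
  have : 0 <= h ^+ 2 * x ^+ 2 by pos.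
  have : 0 <= h * d ^+ 2 by pos.
  have : 0 <= h * x ^+ 2 by pos.
  nra.
rewrite /kern ler_pdivrMr ?exprn_gt0//.
set q := d ^+ 2 + u ^+ 2; set q' := d ^+ 2 + v ^+ 2.
have h1 : 1 <= (1 + h) ^+ 4 by rewrite exprn_ege1// lerDl.
have H2 : q' ^+ 2 <= (1 + h) ^+ 4 * q ^+ 2.
  have -> : (1 + h) ^+ 4 * q ^+ 2 = ((1 + h) ^+ 2 * q) ^+ 2 by ring.
  by rewrite lerXn2r ?nnegrE ?(ltW q0')//; pos.
have -> : (1 + h) ^+ 8 * (2 * d ^+ 3 / q' ^+ 2) * q ^+ 2 =
  2 * d ^+ 3 * (((1 + h) ^+ 8 * q ^+ 2) / q' ^+ 2).
  by ring.
apply: ler_peMr; first by pos.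
rewrite ler_pdivlMr ?exprn_gt0// mul1r.
apply: le_trans H2 _; rewrite ler_wpM2r ?sqr_ge0//.
by rewrite ler_weXn2l// lerDl.
Qed.

(** The kernel is a Laplace transform:
    [kern d u] is the integral over [t >= 0] of [(1 + d t) exp (- d t) cos (u t)].
    [damped_primitive d t u] is the primitive in [t] of that integrand which
    vanishes at infinity; with it, statements about the improper integral become
    statements about a monotone function. *)
Definition damped_primitive d t u : R :=
  let q := d ^+ 2 + u ^+ 2 in
  expR (- (d * t)) *
  (sin (u * t) * ((1 + d * t) * (u / q) + 2 * d ^+ 2 * u / q ^+ 2)
   - cos (u * t) * ((1 + d * t) * (d / q) + d * (d ^+ 2 - u ^+ 2) / q ^+ 2)).

Definition profile d t : R := (1 + d * t) * expR (- (d * t)).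

Lemma is_derive_damped_primitive d t u : 0 < d ->
  is_derive t 1 (fun s => damped_primitive d s u) (profile d t * cos (u * t)).
Proof.
move=> d0; have q0 : d ^+ 2 + u ^+ 2 != 0 by rewrite gt_eqF ?sqD_gt0.
rewrite /damped_primitive /profile.
set q := d ^+ 2 + u ^+ 2.
apply: is_derive_eq.
rewrite /GRing.scale /= !mulr1.
have -> : q = d ^+ 2 + u ^+ 2 by [].
by field.
Qed.

Lemma profile_antitone d e t : 0 <= d -> d <= e -> 0 <= t -> profile e t <= profile d t.
Proof.
move=> d0 de t0; rewrite /profile.
have -> : - (d * t) = (e - d) * t + - (e * t) by ring.
rewrite expRD mulrA ler_wpM2r ?expR_ge0//.
have : 1 + (e - d) * t <= expR ((e - d) * t) by exact: expR_ge1Dx.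
have : 0 <= d * t by pos.
have : 0 <= (e - d) * t by rewrite mulr_ge0// subr_ge0.
move: (expR _) => E; nra.
Qed.

Lemma profile_decay d t : 0 < d -> 0 < t -> profile d t <= 4 / (d * t).
Proof.
move=> d0 t0; rewrite /profile expRN; set x := d * t.
have x0 : 0 < x by rewrite mulr_gt0.
rewrite ler_pdivrMr ?expR_gt0// mulrAC ler_pdivlMr//.
have -> : expR x = expR (x / 2) ^+ 2 by rewrite expr2 -expRD; congr expR; field.
have : 1 + x / 2 <= expR (x / 2) by exact: expR_ge1Dx.
move: (expR _) => E H.
have : (1 + x / 2) ^+ 2 <= E ^+ 2 by rewrite lerXn2r ?nnegrE; nra.
nra.
Qed.

Lemma damped_primitive0 d u : 0 < d -> damped_primitive d 0 u = - kern d u.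
Proof.
move=> d0; have q0 : d ^+ 2 + u ^+ 2 != 0 by rewrite gt_eqF ?sqD_gt0.
rewrite /damped_primitive /kern !mulr0 oppr0 expR0 sin0 cos0; by field.
Qed.

Lemma damped_primitive_decay d u : 0 < d -> exists2 M, 0 <= M &
  forall t, 0 < t -> `|damped_primitive d t u| <= M / t.
Proof.
move=> d0; have q0 := sqD_gt0 u d0.
set q := d ^+ 2 + u ^+ 2.
pose M : R := `|u / q| + `|2 * d ^+ 2 * u / q ^+ 2| + `|d / q|
  + `|d * (d ^+ 2 - u ^+ 2) / q ^+ 2|.
have M0 : 0 <= M by rewrite /M; pos.
exists (M * (4 / d)) => [|t t0]; first by pos.
apply: (@le_trans _ _ (M * profile d t)); last first.
  apply: le_trans (ler_wpM2l M0 (profile_decay d0 t0)) _.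
  by rewrite invfM !mulrA.
rewrite /damped_primitive -/q /profile normrM (ger0_norm (expR_ge0 _)) [leLHS]mulrC [leRHS]mulrA.
rewrite ler_wpM2r ?expR_ge0//.
have x0 : 0 <= d * t by pos.
move: (d * t) x0 => x x0.
apply: le_trans (ler_normB _ _) _.
have H1 A B C : `|C| <= 1 -> `|C * ((1 + x) * A + B)| <= (1 + x) * (`|A| + `|B|).
  move=> C1; rewrite normrM.
  apply: (@le_trans _ _ (`|(1 + x) * A + B|)).
    by rewrite ler_piMl.
  apply: le_trans (ler_normD _ _) _.
  rewrite normrM (ger0_norm (_ : 0 <= 1 + x)); last by pos.
  by rewrite mulrDr lerD2l ler_peMl// lerDl.
have hs : `|sin (u * t)| <= 1 by rewrite ler_norml sin_geN1 sin_le1.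
have hc : `|cos (u * t)| <= 1 by rewrite ler_norml cos_geN1 cos_le1.
apply: le_trans (lerD (H1 _ _ _ hs) (H1 _ _ _ hc)) _.
by rewrite -mulrDr mulrC /M !addrA.
Qed.

(** The form is [|sum w_i exp (i u_i t)|^2], written without complex numbers. *)
Lemma cos_form_ge0 (I : finType) (w u : I -> R) t :
  0 <= \sum_i \sum_j w i * w j * cos ((u i - u j) * t).
Proof.
suff -> : \sum_i \sum_j w i * w j * cos ((u i - u j) * t) =
   (\sum_i w i * cos (u i * t)) ^+ 2 + (\sum_i w i * sin (u i * t)) ^+ 2.
  by pos.
rewrite !expr2 !mulr_suml -big_split/=; apply: eq_bigr => i _.
rewrite !mulr_sumr -big_split/=; apply: eq_bigr => j _.
rewrite mulrBl cosB; ring.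
Qed.

(** By the Laplace representation, [kern d - kern e] is a superposition of the
    functions [cos (u t)], each positive definite, with the weights
    [profile d t - profile e t >= 0].  In terms of primitives: the form [H] built from
    [damped_primitive] is nondecreasing in [t], starts at the opposite of the
    form in question and tends to 0. *)
Lemma kern_form_antitone (I : finType) (w u : I -> R) d e : 0 < d -> d <= e ->
  0 <= \sum_i \sum_j w i * w j * (kern d (u i - u j) - kern e (u i - u j)).
Proof.
move=> d0 de; have e0 : 0 < e by exact: lt_le_trans de.
pose H t := \sum_i \sum_j
  w i * w j * (damped_primitive d t (u i - u j) - damped_primitive e t (u i - u j)).
pose H' t := \sum_i \sum_j
  w i * w j * (profile d t * cos ((u i - u j) * t) - profile e t * cos ((u i - u j) * t)).
have dH t : is_derive t 1 H (H' t).
  apply: is_derive_bigsum => i; apply: is_derive_bigsum => j.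
  by apply: is_deriveMl; apply: is_deriveB; exact: is_derive_damped_primitive.
have H'0 t : 0 <= t -> 0 <= H' t.
  move=> t0; suff -> : H' t = (profile d t - profile e t) *
       \sum_i \sum_j w i * w j * cos ((u i - u j) * t).
    by rewrite mulr_ge0 ?cos_form_ge0// subr_ge0 profile_antitone// ltW.
  rewrite /H' mulr_sumr; apply: eq_bigr => i _.
  rewrite mulr_sumr; apply: eq_bigr => j _; ring.
have H0 : H 0 = - \sum_i \sum_j w i * w j * (kern d (u i - u j) - kern e (u i - u j)).
  rewrite /H -sumrN; apply: eq_bigr => i _; rewrite -sumrN; apply: eq_bigr => j _.
  by rewrite !damped_primitive0//; ring.
have Hmono t : 0 < t -> H 0 <= H t.
  move=> t0; have [c /andP[c0 _]] := mean_value t0 dH.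
  by rewrite subr0 => E; rewrite -subr_ge0 E mulr_ge0 ?(ltW t0)// H'0// ltW.
have [M M0 HM] : exists2 M, 0 <= M & forall t, 0 < t -> H t <= M / t.
  have dec i j : exists2 M, 0 <= M & forall t, 0 < t ->
      w i * w j * (damped_primitive d t (u i - u j) - damped_primitive e t (u i - u j)) <= M / t.
    have [M1 M10 h1] := damped_primitive_decay (u i - u j) d0.
    have [M2 M20 h2] := damped_primitive_decay (u i - u j) e0.
    exists (`|w i * w j| * (M1 + M2)) => [|t t0]; first by pos.
    apply: le_trans (ler_norm _) _; rewrite normrM -mulrA ler_wpM2l//.
    by apply: le_trans (ler_normB _ _) _; rewrite mulrDl; apply: lerD; [exact: h1|exact: h2].
  pose M i j := projT1 (cid2 (dec i j)).
  exists (\sum_i \sum_j M i j) => [|t t0].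
    apply: sumr_ge0 => i _; apply: sumr_ge0 => j _; rewrite /M.
    by case: cid2.
  rewrite /H mulr_suml; apply: ler_sum => i _.
  rewrite mulr_suml; apply: ler_sum => j _; rewrite /M.
  by case: cid2 => /= m _; exact.
rewrite leNgt; apply/negP => Q0.
set Q := \sum_i _ in H0 Q0.
pose t := (M + 1) / - Q.
have t0 : 0 < t by rewrite divr_gt0 ?oppr_gt0// ltr_wpDl.
have := le_trans (Hmono _ t0) (HM _ t0).
rewrite H0 ler_pdivlMr// /t mulrCA divff ?oppr_eq0 ?lt_eqF// mulr1.
by rewrite gerDl ler10.
Qed.


Definition kern_primitive d u : R := atan (u / d) + (u / d) / (1 + (u / d) ^+ 2).

Lemma is_derive_kern_primitive d u : 0 < d -> is_derive u 1 (kern_primitive d) (kern d u).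
Proof.
move=> d0; rewrite /kern_primitive.
have q0 : 1 + (u / d) ^+ 2 != 0 by rewrite gt_eqF// ltr_wpDr ?sqr_ge0.
have q1 : d ^+ 2 + u ^+ 2 != 0 by rewrite gt_eqF// sqD_gt0.
have dn : d != 0 by rewrite gt_eqF.
have D1 : is_derive u 1 (fun s : R => s / d) d^-1.
  by apply: is_derive_eq; rewrite /GRing.scale/= mulr1 mulr0 add0r.
have D2 : is_derive u 1 (fun s : R => atan (s / d)) ((1 + (u / d) ^+ 2)^-1 * d^-1).
  by apply: (@is_derive1_comp _ atan (fun s => s / d)).
have D4 : is_derive u 1 (fun s : R => (1 + (s / d) ^+ 2)^-1)
   (- (1 + (u / d) ^+ 2) ^- 2 * (2 * (u / d) * d^-1)).
  apply: (@is_deriveV _ (fun s : R => (1 + (s / d) ^+ 2))) => //.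
  by apply: is_derive_eq; rewrite /GRing.scale/=; ring.
have D5 := is_deriveM D1 D4.
apply: (is_derive_eq (is_deriveD D2 D5)).
rewrite /GRing.scale/= /kern.
by field; rewrite q1 dn.
Qed.

Lemma is_derive_uatan d u : 0 < d ->
  is_derive u 1 (fun s => s * atan (s / d)) (kern_primitive d u).
Proof.
move=> d0; rewrite /kern_primitive.
have dn : d != 0 by rewrite gt_eqF.
have D1 : is_derive u 1 (fun s : R => s / d) d^-1.
  by apply: is_derive_eq; rewrite /GRing.scale/= mulr1 mulr0 add0r.
have D2 : is_derive u 1 (fun s : R => atan (s / d)) ((1 + (u / d) ^+ 2)^-1 * d^-1).
  by apply: (@is_derive1_comp _ atan (fun s => s / d)).
apply: (is_derive_eq (is_deriveM (is_derive_id u 1) D2)).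
rewrite /GRing.scale/=; ring.
Qed.

Lemma is_derive_affine (f f' : R -> R) (a b x : R) :
  (forall u : R, is_derive u 1 f (f' u)) ->
  is_derive x 1 (fun th => f (b - th * a)) (- a * f' (b - x * a)).
Proof.
move=> df.
have D1 : is_derive x 1 (fun th : R => b - th * a) (- a).
  by apply: is_derive_eq; rewrite /GRing.scale/=; ring.
have H := @is_derive1_comp _ f (fun th => b - th * a) x _ _ (df _) D1.
by apply: (is_derive_eq H); rewrite mulrC.
Qed.

Definition kern_diff L d u : R := kern d u - kern (L * d) u.

(** Each of the two second primitives grows linearly, but their difference is
    bounded: [atan (u / d)] and [atan (u / (L d))] differ by [O (d / u)]. *)
Lemma uatan_diff_bound L d u : 1 <= L -> 0 < d ->
  0 <= u * (atan (u / d) - atan (u / (L * d))) <= L ^+ 2 * d.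
Proof.
move=> L1 d0; have L0 : 0 < L by exact: lt_le_trans L1.
wlog u0 : u / 0 <= u.
  move=> H; have [|u0] := lerP 0 u; first exact: H.
  have := H (- u); rewrite oppr_ge0 => /(_ (ltW u0)).
  by rewrite !(mulNr u (_^-1)) !atanN -opprD mulrNN.
have Ld : u / (L * d) <= u / d.
  by rewrite ler_wpM2l// lef_pV2 ?posrE ?mulr_gt0// ler_peMl// ltW.
move: Ld; rewrite le_eqVlt => /predU1P[->|Ld].
  by rewrite subrr mulr0 lexx/=; pos.
have [c /andP[c1 c2] E] := mean_value Ld (fun x => is_derive1_atan x).
have uLd0 : 0 <= u / (L * d) by rewrite divr_ge0// mulr_ge0// ltW.
rewrite E; apply/andP; split.
  rewrite mulr_ge0// mulr_ge0 ?subr_ge0 ?(ltW Ld)// invr_ge0; pos.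
have up : 0 < u.
  rewrite lt_neqAle u0 andbT; apply/eqP => u00; move: Ld.
  by rewrite -u00 !mul0r ltxx.
rewrite mulrCA mulrC ler_pdivrMr; last by rewrite ltr_wpDr ?sqr_ge0.
have c2' : (u / (L * d)) ^+ 2 <= c ^+ 2.
  by rewrite lerXn2r ?nnegrE// ltW// (le_lt_trans uLd0).
apply: (@le_trans _ _ (L ^+ 2 * d * (u / (L * d)) ^+ 2)); last first.
  by rewrite ler_wpM2l; [|pos|rewrite ler_wpDl].
have -> : L ^+ 2 * d * (u / (L * d)) ^+ 2 = u * (u / d).
  by field; rewrite !gt_eqF.
by rewrite ler_wpM2l// gerBl.
Qed.

(** [B' 1 - B' (-1)], the integral of the kernel increment over slopes in [[-1, 1]],
    would not decay well because the sharp ends contribute; averaging the integral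
    over the intervals [[-r, r]] for [r] in [[1, 2]] gives the second difference of [B]
    below.  When [|a|] dominates, the second primitive divided by [a^2] bounds it;
    otherwise the integrand is small throughout. *)
Lemma second_antiderivative L d a b : 1 <= L -> 0 < d ->
  exists B B' : R -> R,
  [/\ forall x : R, is_derive x 1 B (B' x),
      forall x : R, is_derive x 1 B' (kern_diff L d (b - x * a)) &
      B 2 - B 1 + (B (- 2) - B (- 1)) <=
        200 * L ^+ 2 * d / (d ^+ 2 + a ^+ 2 + b ^+ 2)].
Proof.
move=> L1 d0; have L0 : 0 < L by exact: lt_le_trans L1.
have Ld0 : 0 < L * d by rewrite mulr_gt0.
set S := d ^+ 2 + a ^+ 2 + b ^+ 2.
have S0 : 0 < S by rewrite /S -addrA ltr_wpDr ?addr_ge0 ?sqr_ge0// exprn_gt0.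
have L21 : 1 <= L ^+ 2 by exact: exprn_ege1.
(* For [a = 0] the increment does not depend on the slope. *)
pose B0 (x : R) := if a == 0 then x ^+ 2 / 2 * kern_diff L d b else
  (a ^+ 2)^-1 * ((b - x * a) * atan ((b - x * a) / d) -
   (b - x * a) * atan ((b - x * a) / (L * d))).
pose B1 (x : R) := if a == 0 then x * kern_diff L d b else
  - a^-1 * (kern_primitive d (b - x * a) - kern_primitive (L * d) (b - x * a)).
have dB (x : R) : is_derive x 1 B0 (B1 x).
  rewrite /B0 /B1; case: eqP => [a0|/eqP a0].
    by apply: is_derive_eq; rewrite /GRing.scale/=; field.
  have H := is_deriveMl (a ^+ 2)^-1 (is_deriveB
    (is_derive_affine a b x (fun u => is_derive_uatan u d0))
    (is_derive_affine a b x (fun u => is_derive_uatan u Ld0))).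
  by apply: (is_derive_eq H); field.
have dB' (x : R) : is_derive x 1 B1 (kern_diff L d (b - x * a)).
  rewrite /B1; case: eqP => [a0|/eqP a0].
    by apply: is_derive_eq; rewrite /GRing.scale/= a0 mulr0 subr0; ring.
  have H := is_deriveMl (- a^-1) (is_deriveB
    (is_derive_affine a b x (fun u => is_derive_kern_primitive u d0))
    (is_derive_affine a b x (fun u => is_derive_kern_primitive u Ld0))).
  by apply: (is_derive_eq H); rewrite /kern_diff; field.
exists B0, B1; split => //.
(* The second difference is [2 c] times a value of the increment, with [c < 2]. *)
have MV K : 0 <= K -> (forall x, -2 <= x <= 2 -> kern_diff L d (b - x * a) <= K) ->
    B0 2 - B0 1 + (B0 (- 2) - B0 (- 1)) <= 4 * K.
  move=> K0 HK.
  have dh (x : R) : is_derive x 1 (fun x => B0 x + B0 (- x)) (B1 x - B1 (- x)).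
    apply: is_deriveD; rewrite -mulrN1.
    exact: (@is_derive1_comp _ B0 (fun x => - x)).
  have [c /andP[c1 c2] E] := mean_value (ltr1n R 2 : 1 < 2) dh.
  (* A second application, to [B1] on [[-c, c]]. *)
  have cc : - c < c by lra.
  have [e /andP[e1 e2] E'] := mean_value cc dB'.
  have ek : kern_diff L d (b - e * a) <= K by apply: HK; lra.
  have : B0 2 - B0 1 + (B0 (- 2) - B0 (- 1)) = (2 * c) * kern_diff L d (b - e * a).
    by move: E E'; nra.
  by move=> ->; nra.
have dk x : kern_diff L d x <= kern d x by rewrite /kern_diff gerBl kern_ge0.
have fin K : K <= 50 * d / S -> 4 * K <= 200 * L ^+ 2 * d / S.
  move=> KS; apply: (@le_trans _ _ (4 * (50 * d / S))); first by rewrite ler_wpM2l.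
  rewrite !mulrA ler_wpM2r ?invr_ge0 ?(ltW S0)// ler_wpM2r ?(ltW d0)//.
  lra.
have [ba|ab] := lerP (4 * `|a|) `|b|.
  apply: le_trans (MV (50 * d / S) _ _) (fin _ _) => //; first by rewrite divr_ge0//; pos.
  move=> x /andP[x1 x2]; apply: le_trans (dk _) _.
  set u := b - x * a; have q0 := sqD_gt0 u d0.
  have Su : S <= 5 * (d ^+ 2 + u ^+ 2).
    have : `|b| / 2 <= `|u|.
      have xa : `|x * a| <= 2 * `|a|.
        by rewrite normrM ler_wpM2r// ler_norml x1.
      have := lerB_dist b (x * a); rewrite -/u; lra.
    move: ba; rewrite /S -(real_normK (num_real a)) -(real_normK (num_real b))
      -(real_normK (num_real u)).
    have := normr_ge0 a; have := normr_ge0 b; have := normr_ge0 u.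
    move: `|a| `|b| `|u| => A B U; nra.
  rewrite /kern ler_pdivrMr ?exprn_gt0// mulrAC ler_pdivlMr//.
  have dS : d ^+ 2 <= d ^+ 2 + u ^+ 2 by rewrite lerDl sqr_ge0.
  set q := d ^+ 2 + u ^+ 2 in q0 Su dS *.
  apply: (@le_trans _ _ (2 * d * (q * (5 * q)))); last first.
    have : 0 <= d * q ^+ 2 by pos.
    by lra.
  have -> : 2 * d ^+ 3 * S = 2 * d * (d ^+ 2 * S) by ring.
  rewrite ler_wpM2l//; first by pos.
  by rewrite ler_pM ?sqr_ge0 ?(ltW S0).
have ab2 : b ^+ 2 <= 16 * a ^+ 2.
  rewrite -(real_normK (num_real a)) -(real_normK (num_real b)).
  have := normr_ge0 a; have := normr_ge0 b; move: ab; move: `|a| `|b| => A B; nra.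
have [ad|da] := lerP `|a| d.
  apply: le_trans (MV (50 * d / S) _ _) (fin _ _) => //; first by rewrite divr_ge0//; pos.
  move=> x _; apply: le_trans (dk _) _; apply: le_trans (kern_le _ d0) _.
  have a2 : a ^+ 2 <= d ^+ 2.
    by rewrite -(real_normK (num_real a)) lerXn2r ?nnegrE//; pos.
  rewrite ler_pdivrMr// mulrAC ler_pdivlMr// /S; nra.
have a2 : d ^+ 2 <= a ^+ 2.
  by rewrite -(real_normK (num_real a)) lerXn2r ?nnegrE//; pos.
have a0 : a != 0.
  by apply: contraTN da => /eqP->; rewrite normr0 -leNgt ltW.
have a20 : 0 < a ^+ 2 by rewrite lt_neqAle sqr_ge0 andbT eq_sym sqrf_eq0.
have BE x : 0 <= B0 x <= L ^+ 2 * d / a ^+ 2.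
  rewrite /B0 (negbTE a0) -mulrBr.
  have /andP[p1 p2] := uatan_diff_bound (b - x * a) L1 d0.
  by rewrite mulr_ge0 ?invr_ge0 ?(ltW a20)//= mulrC ler_wpM2r// invr_ge0 ltW.
apply: (@le_trans _ _ (2 * (L ^+ 2 * d / a ^+ 2))).
  have := BE 1; have := BE 2; have := BE (-1); have := BE (-2); lra.
have -> : 2 * (L ^+ 2 * d / a ^+ 2) = L ^+ 2 * d * (2 / a ^+ 2) by ring.
have -> : 200 * L ^+ 2 * d / S = L ^+ 2 * d * (200 / S) by ring.
rewrite ler_wpM2l//; first by pos.
rewrite ler_pdivrMr// mulrAC ler_pdivlMr// /S; nra.
Qed.
End Kernel.

(** * Energies of planar projections: passing from one scale to the next *)

Section Planar.
Variable R : realType.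
Variables (I J : finType) (w a b : I -> R) (nu th : J -> R).
Hypothesis w0 : forall i, 0 <= w i.
Hypothesis nu0 : forall j, 0 <= nu j.
Hypothesis th1 : forall j, -1 <= th j < 1.
Hypothesis a1 : forall i i', `|a i - a i'| <= 1.

(** The square norm, at resolution [d], of the image of the mass [w] under the form
    [b - x * a]. *)
Definition energy (d x : R) : R :=
  \sum_i \sum_i' w i * w i' * kern d ((b i - b i') - x * (a i - a i')).

Definition avg_energy (d : R) : R := \sum_j nu j * energy d (th j).

Lemma energy_ge0 d x : 0 < d -> 0 <= energy d x.
Proof.
move=> d0; apply: sumr_ge0 => i _; apply: sumr_ge0 => i' _.
by rewrite mulr_ge0 ?kern_ge0// mulr_ge0.
Qed.

Lemma energy_harnack d h x y : 0 < d -> 0 <= h -> `|x - y| <= h * d ->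
  energy d x <= (1 + h) ^+ 8 * energy d y.
Proof.
move=> d0 h0 xy; rewrite /energy mulr_sumr; apply: ler_sum => i _.
rewrite mulr_sumr; apply: ler_sum => i' _; rewrite [leRHS]mulrCA.
rewrite ler_wpM2l ?mulr_ge0//; apply: kern_harnack => //.
rewrite opprB addrC subrKA -mulrBl normrM distrC.
by apply: le_trans xy; rewrite ler_piMr.
Qed.

Lemma energy_diff L d x : energy d x - energy (L * d) x =
  \sum_i \sum_i' w i * w i' * kern_diff L d ((b i - b i') - x * (a i - a i')).
Proof.
rewrite /energy -sumrB; apply: eq_bigr => i _; rewrite -sumrB; apply: eq_bigr => i' _.
by rewrite -mulrBr.
Qed.

Lemma energy_antitone L d x : 1 <= L -> 0 < d -> energy (L * d) x <= energy d x.
Proof.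
move=> L1 d0; rewrite -subr_ge0 energy_diff.
have := kern_form_antitone w (fun i => b i - x * a i) d0 (_ : d <= L * d).
rewrite ler_peMl ?(ltW d0)// => /(_ isT).
suff -> : \sum_i \sum_i' w i * w i' * kern_diff L d ((b i - b i') - x * (a i - a i'))
 = \sum_i \sum_i' w i * w i' * (kern d (b i - x * a i - (b i' - x * a i'))
   - kern (L * d) (b i - x * a i - (b i' - x * a i'))) by [].
apply: eq_bigr => i _; apply: eq_bigr => i' _; congr (_ * _).
rewrite /kern_diff.
by rewrite (_ : b i - b i' - x * (a i - a i') = b i - x * a i - (b i' - x * a i'))//; ring.
Qed.

(** The integral of the energy increment over slopes in [[-1, 1]] is at most its
    average over the larger intervals [[-r, r]], as the increment is nonnegative; the
    average is what [second_antiderivative] bounds. *)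
Lemma energy_antiderivative L d G : 1 <= L -> 0 < d ->
  \sum_i \sum_i' w i * w i' *
    (200 * L ^+ 2 * d / (d ^+ 2 + (a i - a i') ^+ 2 + (b i - b i') ^+ 2)) <= G ->
  exists B' : R -> R,
   [/\ forall x : R, is_derive x 1 B' (energy d x - energy (L * d) x) &
       B' 1 - B' (-1) <= G].
Proof.
move=> L1 d0 HG.
have ex i i' := second_antiderivative (a i - a i') (b i - b i') L1 d0.
pose B i i' := projT1 (cid (ex i i')).
pose B' i i' := projT1 (cid (projT2 (cid (ex i i')))).
have dB i i' (x : R) : is_derive x 1 (B i i') (B' i i' x).
  by rewrite /B /B'; case: cid => ? /= ?; case: cid => ? [].
have dB' i i' (x : R) : is_derive x 1 (B' i i') (kern_diff L d (b i - b i' - x * (a i - a i'))).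
  by rewrite /B'; case: cid => ? /= ?; case: cid => ? [].
have BG i i' : B i i' 2 - B i i' 1 + (B i i' (- 2) - B i i' (- 1)) <=
    200 * L ^+ 2 * d / (d ^+ 2 + (a i - a i') ^+ 2 + (b i - b i') ^+ 2).
  by rewrite /B; case: cid => ? /= [? []].
pose S x := \sum_i \sum_i' w i * w i' * B i i' x.
pose S' x := \sum_i \sum_i' w i * w i' * B' i i' x.
have dS (x : R) : is_derive x 1 S (S' x).
  by apply: is_derive_bigsum => i; apply: is_derive_bigsum => i'; exact: is_deriveMl.
have dS' (x : R) : is_derive x 1 S' (energy d x - energy (L * d) x).
  rewrite energy_diff.
  by apply: is_derive_bigsum => i; apply: is_derive_bigsum => i'; exact: is_deriveMl.
exists S'; split => //; apply: le_trans HG.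
have mono x y : x < y -> S' x <= S' y.
  move=> xy; have [c _ E] := mean_value xy dS'.
  by rewrite -subr_ge0 E mulr_ge0 ?subr_ge0 ?(ltW xy)// energy_antitone.
have dh (x : R) : is_derive x 1 (fun x => S x + S (- x)) (S' x - S' (- x)).
  apply: is_deriveD; rewrite -mulrN1.
  exact: (@is_derive1_comp _ S (fun x => - x)).
have [c /andP[c1 c2] E] := mean_value (ltr1n R 2 : 1 < 2) dh.
have m1 := mono _ _ c1; have m2 := mono (- c) (-1) (_ : - c < -1).
rewrite ltrN2 in m2; have {}m2 := m2 c1.
apply: (@le_trans _ _ (S 2 - S 1 + (S (-2) - S (-1)))); first lra.
rewrite /S -!sumrB -big_split/=; apply: ler_sum => i _.
rewrite -!sumrB -big_split/=; apply: ler_sum => i' _.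
by rewrite -!mulrBr -mulrDr ler_wpM2l ?mulr_ge0.
Qed.

(** Cut the slopes into intervals of length [1/N].  On each of them the energy at
    resolution [d] is nearly constant, hence close to its mean value, which is the
    energy at resolution [L * d] plus an increment; the increments over all
    intervals are controlled by the integral over [[-1, 1]] because each interval
    carries mass at most [V]. *)
Lemma energy_step L d h G V (N : nat) : 1 <= L -> 0 < d -> (0 < N)%N ->
  0 <= h -> N%:R^-1 = h * d ->
  (forall j0, \sum_(j | `|th j - th j0| <= N%:R^-1) nu j <= V) -> 0 <= V ->
  \sum_i \sum_i' w i * w i' *
    (200 * L ^+ 2 * d / (d ^+ 2 + (a i - a i') ^+ 2 + (b i - b i') ^+ 2)) <= G ->
  avg_energy d <=
    (1 + h) ^+ 16 * avg_energy (L * d) + (1 + h) ^+ 8 * (N%:R * (V * G)).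
Proof.
move=> L1 d0 N0 h0 Nh HV V0 HG.
have L0 : 0 < L by exact: lt_le_trans L1.
have Ld0 : 0 < L * d by rewrite mulr_gt0.
have NR : 0 < N%:R :> R by rewrite ltr0n.
have [B' [dB' B'G]] := energy_antiderivative L1 d0 HG.
pose p (l : nat) : R := l%:R / N%:R - 1.
have pS l : p l.+1 - p l = N%:R^-1.
  by rewrite /p -natr1; field; rewrite gt_eqF.
have plt l : p l < p l.+1 by rewrite -subr_gt0 pS invr_gt0.
(* [c l] is a point of the [l]-th interval at which the increment takes its mean. *)
have exc l : exists c, p l < c < p l.+1 /\
    B' (p l.+1) - B' (p l) = (energy d c - energy (L * d) c) / N%:R.
  by have [c cl E] := mean_value (plt l) dB'; exists c; rewrite E pS.
pose c l := projT1 (cid (exc l)).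
have cP l : p l < c l < p l.+1 by rewrite /c; case: cid => ? [].
have cE l : energy d (c l) =
    energy (L * d) (c l) + N%:R * (B' (p l.+1) - B' (p l)).
  rewrite /c; case: cid => x /= [_ ->]; field; by rewrite gt_eqF.
have D0 l : 0 <= B' (p l.+1) - B' (p l).
  rewrite /c; case: (exc l) => x [_ ->].
  by rewrite mulr_ge0 ?invr_ge0 ?(ltW NR)// subr_ge0 energy_antitone.
pose cell j := Num.truncn ((th j + 1) * N%:R).
have cellP j : p (cell j) <= th j < p (cell j).+1.
  have t0 : 0 <= (th j + 1) * N%:R.
    by rewrite mulr_ge0 ?(ltW NR)// -lerBlDr sub0r; case/andP: (th1 j).
  have /andP[h1 h2] := truncn_itv t0.
  by rewrite /p lerBlDr ltrBrDr ler_pdivrMr// ltr_pdivlMr// h1 h2.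
have cellN j : (cell j < 2 * N)%N.
  have /andP[h1 _] := cellP j; have /andP[_ h2] := th1 j.
  have := le_lt_trans h1 h2; rewrite /p ltrBlDr ltr_pdivrMr// -(ltr_nat R) natrM.
  by lra.
have near_c j : `|th j - c (cell j)| <= h * d.
  rewrite -Nh -(pS (cell j)) ler_norml.
  have /andP[? ?] := cellP j; have /andP[? ?] := cP (cell j).
  by apply/andP; split; lra.
have Hj j : energy d (th j) <= (1 + h) ^+ 16 * energy (L * d) (th j) +
    (1 + h) ^+ 8 * (N%:R * (B' (p (cell j).+1) - B' (p (cell j)))).
  apply: le_trans (energy_harnack d0 h0 (near_c j)) _.
  rewrite cE mulrDr lerD2r -[16%N]/(8 + 8)%N exprD -mulrA.
  rewrite ler_wpM2l; [|by pos|].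
    by [].
  apply: energy_harnack => //; rewrite distrC; apply: le_trans (near_c j) _.
  by rewrite ler_wpM2l// ler_peMl// ltW.
apply: (@le_trans _ _ (\sum_j (nu j * ((1 + h) ^+ 16 * energy (L * d) (th j)) +
    nu j * ((1 + h) ^+ 8 * (N%:R * (B' (p (cell j).+1) - B' (p (cell j)))))))).
  by apply: ler_sum => j _; rewrite -mulrDr ler_wpM2l.
rewrite big_split/= lerD//.
  by rewrite /avg_energy mulr_sumr ler_sum// => j _; rewrite mulrCA.
rewrite (eq_bigr (fun j => (1 + h) ^+ 8 * N%:R *
    (nu j * (B' (p (cell j).+1) - B' (p (cell j)))))); last first.
  by move=> j _; ring.
rewrite -mulr_sumr -mulrA ler_wpM2l; [|by pos|] => //.
rewrite ler_wpM2l ?(ltW NR)//.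
rewrite (partition_big (fun j => Ordinal (cellN j)) xpredT)//=.
apply: (@le_trans _ _ (\sum_(l < 2 * N) V * (B' (p l.+1) - B' (p l)))).
  apply: ler_sum => l _.
  rewrite (eq_bigr (fun j => nu j * (B' (p l.+1) - B' (p l)))); last first.
    by move=> j /eqP <-.
  rewrite -mulr_suml ler_wpM2r//.
  have [j0 /eqP j0l|none] := pickP (fun j => Ordinal (cellN j) == l); last first.
    by rewrite big1// => j; rewrite none.
  apply: le_trans (HV j0); rewrite big_mkcond [leRHS]big_mkcond/=; apply: ler_sum => j _.
  case: eqP => [jl|_]; last by case: ifP.
  suff -> : `|th j - th j0| <= N%:R^-1 by [].
  have lE : cell j = l by rewrite -jl.
  have lE0 : cell j0 = l by rewrite -j0l.
  have := cellP j; have := cellP j0; rewrite lE lE0 => /andP[? ?] /andP[? ?].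
  by rewrite -(pS l) ler_norml; apply/andP; split; lra.
rewrite -mulr_sumr ler_wpM2l//; apply: le_trans B'G.
rewrite -(big_mkord xpredT (fun l => B' (p l.+1) - B' (p l))).
rewrite telescope_sumr//.
by rewrite /p mul0r sub0r natrM mulfK ?gt_eqF// (_ : 2 - 1 = 1)//; lra.
Qed.

End Planar.

(** * Energies of planar projections: all scales together *)

Section Numeric.
Variable R : realType.

(** The term of the largest [n] for which both coordinates are at most [32^(-n)]
    dominates; the invariant [key] says either that no such [n] has been passed or
    that its term already does. *)
Lemma inv_sq_dyadic (x y : R) (N : nat) : `|x| <= 1 -> `|y| <= 1 ->
  ((32 ^+ N)^-1 ^+ 2 + x ^+ 2 + y ^+ 2)^-1 <=
  \sum_(n < N.+1) (if (`|x| <= (32 ^+ n)^-1) && (`|y| <= (32 ^+ n)^-1)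
                   then (32 : R) ^+ n.+1 ^+ 2 else 0).
Proof.
move=> x1 y1.
pose t (n : nat) := if (`|x| <= (32 ^+ n)^-1) && (`|y| <= (32 ^+ n)^-1)
                   then (32 : R) ^+ n.+1 ^+ 2 else 0.
have t0 n : 0 <= t n by rewrite /t; case: ifP => // _; pos.
have key M : ((`|x| <= (32 ^+ M)^-1) && (`|y| <= (32 ^+ M)^-1)) \/
   (0 < x ^+ 2 + y ^+ 2 /\ (x ^+ 2 + y ^+ 2)^-1 <= \sum_(n < M) t n).
  elim: M => [|M [IH|[p IH]]]; first by left; rewrite expr0 invr1 x1 y1.
    have [|far] := boolP ((`|x| <= (32 ^+ M.+1)^-1) && (`|y| <= (32 ^+ M.+1)^-1)).
      by left.
    right.
    have e0 : 0 < (32 ^+ M.+1)^-1 :> R by rewrite invr_gt0 exprn_gt0.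
    have big : (32 ^+ M.+1)^-1 ^+ 2 <= x ^+ 2 + y ^+ 2.
      move: far; rewrite negb_and -!ltNge => /orP[h|h].
        rewrite -(real_normK (num_real x)) ler_wpDr ?sqr_ge0// lerXn2r//; pos.
      rewrite -(real_normK (num_real y)) ler_wpDl ?sqr_ge0// lerXn2r//; pos.
    have p : 0 < x ^+ 2 + y ^+ 2 by apply: lt_le_trans big; rewrite exprn_gt0.
    split=> //; rewrite big_ord_recr/=.
    apply: (@le_trans _ _ (t M)); last by rewrite lerDr sumr_ge0.
    rewrite /t IH; rewrite exprVn in big.
    by rewrite -[leRHS]invrK lef_pV2 ?posrE ?invr_gt0 ?exprn_gt0.
  by right; split=> //; rewrite big_ord_recr/=; apply: le_trans IH _; rewrite lerDl.
have d0 : 0 < (32 ^+ N)^-1 ^+ 2 :> R by rewrite exprn_gt0// invr_gt0 exprn_gt0.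
rewrite big_ord_recr/=; have [hN|[p hp]] := key N; last first.
  apply: le_trans (_ : (x ^+ 2 + y ^+ 2)^-1 <= _).
    by move: d0; move: (_^-1 ^+ 2) => D d0; rewrite lef_pV2 ?posrE//; lra.
  by apply: le_trans hp _; rewrite lerDl; exact: t0.
rewrite hN; apply: ler_wpDl; first by rewrite sumr_ge0// => i _; exact: t0.
apply: (@le_trans _ _ ((32 ^+ N)^-1 ^+ 2)^-1).
  have := sqr_ge0 x; have := sqr_ge0 y; move: d0; move: (_^-1 ^+ 2) => D d0 ? ?.
  by rewrite lef_pV2 ?posrE//; lra.
rewrite exprVn invrK lerXn2r//; try by pos.
by rewrite ler_eXn2l// ltr1n.
Qed.

Lemma sum_pow4 (N : nat) : \sum_(n < N.+1) (4 : R) ^+ n <= 2 * 4 ^+ N.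
Proof.
elim: N => [|N IH]; first by rewrite big_ord1 !expr0; lra.
rewrite big_ord_recr/=; apply: le_trans (lerD IH (lexx _)) _.
rewrite [4 ^+ N.+1]exprS; have : 0 <= (4 : R) ^+ N by pos.
lra.
Qed.

Lemma exprM_pow2 (c : R) (k m q : nat) : c = 2 ^+ k -> c ^+ (m * q) = (2 ^+ q) ^+ (k * m).
Proof. by move=> ->; rewrite -!exprM mulnA mulnC. Qed.

End Numeric.

Section PlanarBound.
Variable R : realType.
Variables (I J : finType) (w a b : I -> R) (nu th : J -> R).
Hypothesis w0 : forall i, 0 <= w i.
Hypothesis nu0 : forall j, 0 <= nu j.
Hypothesis w1 : \sum_i w i <= 1.
Hypothesis nu1 : \sum_j nu j <= 1.
Hypothesis th1 : forall j, -1 <= th j < 1.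
Hypothesis a1 : forall i i', `|a i - a i'| <= 1.
Hypothesis b1 : forall i i', `|b i - b i'| <= 1.
Variables (C : R) (K : nat).
Hypothesis C0 : 0 <= C.
Hypothesis ballC : forall i n, (n <= 3 * K)%N ->
  \sum_(i' | (`|a i - a i'| <= (32 ^+ n)^-1) && (`|b i - b i'| <= (32 ^+ n)^-1)) w i'
    <= C / 256 ^+ n.
Hypothesis arcC : forall j m, (m <= 4 * K)%N ->
  \sum_(j' | `|th j' - th j| <= (32 ^+ m)^-1) nu j' <= C / 8 ^+ m.

(** With mass [256^(-n)] on squares of radius [32^(-n)], the dyadic sum has terms of
    order [32^(2n) * 256^(-n) = 4^n], so that the last one dominates. *)
Lemma riesz_energy (N : nat) : (N <= 3 * K)%N ->
  \sum_i \sum_i' w i * w i' *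
    ((32 ^+ N)^-1 ^+ 2 + (a i - a i') ^+ 2 + (b i - b i') ^+ 2)^-1
  <= 2 * 32 ^+ 2 * C * 4 ^+ N.
Proof.
move=> NK.
have H i : \sum_i' w i' *
    ((32 ^+ N)^-1 ^+ 2 + (a i - a i') ^+ 2 + (b i - b i') ^+ 2)^-1
    <= 2 * 32 ^+ 2 * C * 4 ^+ N.
  apply: (@le_trans _ _ (\sum_i' w i' * \sum_(n < N.+1)
      (if (`|a i - a i'| <= (32 ^+ n)^-1) && (`|b i - b i'| <= (32 ^+ n)^-1)
                   then (32 : R) ^+ n.+1 ^+ 2 else 0))).
    by apply: ler_sum => i' _; rewrite ler_wpM2l// inv_sq_dyadic.
  under eq_bigr do rewrite mulr_sumr.
  rewrite exchange_big/=.
  apply: (@le_trans _ _ (\sum_(n < N.+1) (32 ^+ 2 * C) * 4 ^+ n)).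
    apply: ler_sum => n _.
    have nK : (n <= 3 * K)%N by apply: leq_trans NK; rewrite -ltnS.
    rewrite (_ : \sum_i' _ = (32 : R) ^+ n.+1 ^+ 2 *
      \sum_(i' | (`|a i - a i'| <= (32 ^+ n)^-1) && (`|b i - b i'| <= (32 ^+ n)^-1)) w i').
      apply: le_trans (ler_wpM2l _ (ballC i nK)) _; first by pos.
      rewrite [32 ^+ n.+1]exprS exprMn -exprM mulnC exprM.
      have -> : ((32 : R) ^+ 2) ^+ n = 4 ^+ n * 256 ^+ n by rewrite -exprMn; congr (_ ^+ _); lra.
      have : (256 : R) ^+ n != 0 by rewrite expf_eq0 pnatr_eq0 andbF.
      move: (256 ^+ n) => X X0.
      by rewrite le_eqVlt; apply/orP; left; apply/eqP; field.
    rewrite [in RHS]big_mkcond mulr_sumr; apply: eq_bigr => i' _.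
    by case: ifP => _; rewrite ?mulr0// mulrC.
  rewrite -mulr_sumr; apply: le_trans (ler_wpM2l _ (sum_pow4 _ N)) _; first by pos.
  by rewrite mulrA; apply: ler_wpM2r; [pos|rewrite le_eqVlt; apply/orP; left; apply/eqP; ring].
under eq_bigr do under eq_bigr do rewrite -mulrA.
under eq_bigr do rewrite -mulr_sumr.
apply: (@le_trans _ _ (\sum_i w i * (2 * 32 ^+ 2 * C * 4 ^+ N))).
  by apply: ler_sum => i _; rewrite ler_wpM2l.
by rewrite -mulr_suml; apply: ler_piMl; [pos|exact: w1].
Qed.

(** The step from [32^(-3(q-1))] to [32^(-3q)] uses [N = 32^(4q)] intervals of slopes.
    Its multiplicative error is [(1 + 32^(-q))^16] and its additive error, from the
    two dimension bounds, is of order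
    [32^(4q) * 8^(-4q) * 32^(-3q) * 4^(3q) = 2^(-q)].  Both are summable. *)
Lemma planar_energy_bound :
  avg_energy w a b nu th (32 ^+ (3 * K))^-1 <=
    expR 1 * (2 + 200 * 2 * 32 ^+ 8 * C ^+ 2).
Proof.
set A := 200 * 2 * 32 ^+ 8 * C ^+ 2.
have A0 : 0 <= A by rewrite /A; pos.
pose T (j : nat) := avg_energy w a b nu th (32 ^+ (3 * j))^-1.
pose h (j : nat) : R := (32 ^+ j)^-1.
have h0 j : 0 <= h j by rewrite /h; pos.
(* [expR (1 - h j)] bounds the product of the multiplicative errors, as
   [16 * 32^(-q)] is at most the increment [31 * 32^(-q)] of the exponent. *)
suff claim j : (j <= K)%N -> T j <= expR (1 - h j) * (2 + A * (1 - (2 ^+ j)^-1)).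
  apply: le_trans (claim K (leqnn _)) _.
  apply: ler_pM; rewrite ?expR_ge0//.
  - by rewrite addr_ge0// mulr_ge0// subr_ge0 invf_le1 ?exprn_gt0// exprn_ege1// ler1n.
  - by rewrite ler_expR lerBlDr lerDl.
  - rewrite lerD2l ler_piMr// lerBlDr lerDl; pos.
elim: j => [_|j IH jK].
  rewrite /h !expr0 invr1 subrr expR0 mul1r mulr0 addr0 /T muln0 expr0 invr1.
  rewrite /avg_energy; apply: (@le_trans _ _ (\sum_j nu j * 2)); last first.
    by rewrite -mulr_suml ler_piMl.
  apply: ler_sum => j _; rewrite ler_wpM2l// /energy.
  apply: (@le_trans _ _ (\sum_i \sum_i' w i * (w i' * 2))).
    apply: ler_sum => i _; apply: ler_sum => i' _; rewrite -mulrA.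
    rewrite !ler_wpM2l//; apply: le_trans (kern_le _ ltr01) _; by rewrite divr1.
  under eq_bigr do rewrite -mulr_sumr -mulr_suml.
  rewrite -mulr_suml.
  have : 0 <= \sum_i w i by rewrite sumr_ge0.
  by move: w1; move: (\sum_i w i) => W; nra.
move: (IH (ltnW jK)) => {}IH; set q := j.+1.
have X0 : 0 < (2 : R) ^+ q by rewrite exprn_gt0.
have E32 : (32 : R) = 2 ^+ 5 by ring.
have E8 : (8 : R) = 2 ^+ 3 by ring.
have E4 : (4 : R) = 2 ^+ 2 by ring.
have dE : (32 ^+ (3 * j))^-1 = 32 ^+ 3 * (32 ^+ (3 * q))^-1 :> R.
  rewrite /q mulnS exprD invfM mulrA mulfV ?mul1r// expf_eq0 pnatr_eq0 andbF//.
have NE : (32 ^ (4 * q))%:R^-1 = h q * (32 ^+ (3 * q))^-1 :> R.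
  by rewrite /h -invfM -exprD natrX mulSn.
have arc j0 : \sum_(j' | `|th j' - th j0| <= (32 ^ (4 * q))%:R^-1) nu j' <= C / 8 ^+ (4 * q).
  by rewrite natrX; apply: arcC; rewrite leq_mul2l jK orbT.
have L1 : 1 <= (32 : R) ^+ 3 by rewrite exprn_ege1// ler1n.
have d0 : 0 < (32 ^+ (3 * q))^-1 :> R by rewrite invr_gt0 exprn_gt0.
have N0 : (0 < 32 ^ (4 * q))%N by rewrite expn_gt0.
have V0 : 0 <= C / 8 ^+ (4 * q) by pos.
set d : R := (32 ^+ (3 * q))^-1 in dE NE d0 *.
have riesz : \sum_i \sum_i' w i * w i' *
    (200 * (32 ^+ 3) ^+ 2 * d / (d ^+ 2 + (a i - a i') ^+ 2 + (b i - b i') ^+ 2))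
    <= 200 * (32 ^+ 3) ^+ 2 * d * (2 * 32 ^+ 2 * C * 4 ^+ (3 * q)).
  have q3 : (3 * q <= 3 * K)%N by rewrite leq_mul2l jK orbT.
  have P0 : 0 <= 200 * (32 ^+ 3) ^+ 2 * d by pos.
  apply: le_trans (ler_wpM2l P0 (riesz_energy q3)).
  rewrite mulr_sumr le_eqVlt; apply/orP; left; apply/eqP; apply: eq_bigr => i _.
  by rewrite mulr_sumr; apply: eq_bigr => i' _; rewrite [RHS]mulrCA.
have := energy_step w0 nu0 th1 a1 L1 d0 N0 (h0 q) NE arc V0 riesz.
rewrite -dE -/(T j) -/(T q).
have -> : (32 ^ (4 * q))%:R * (C / 8 ^+ (4 * q) *
     (200 * (32 ^+ 3) ^+ 2 * d * (2 * 32 ^+ 2 * C * 4 ^+ (3 * q)))) = A * (2 ^+ q)^-1.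
  rewrite natrX /A /d (exprM_pow2 4 q E32) (exprM_pow2 3 q E32) (exprM_pow2 4 q E8) (exprM_pow2 3 q E4).
  move: (2 ^+ q) X0 => X X0; field; by rewrite gt_eqF.
move=> step; apply: le_trans step _.
have hE : h j = 32 * h q.
  by rewrite /h /q [32 ^+ j.+1]exprS invfM mulrA mulfV ?mul1r// pnatr_eq0.
have twoE : (2 ^+ j)^-1 = 2 * (2 ^+ q)^-1 :> R.
  by rewrite /q exprS invfM mulrA mulfV ?mul1r// pnatr_eq0.
have hq1 : h q <= 1 by rewrite /h invf_le1 ?exprn_gt0// exprn_ege1// ler1n.
have E16 : (1 + h q) ^+ 16 <= expR (31 * h q).
  apply: (@le_trans _ _ (expR (h q) ^+ 16)).
    by rewrite lerXn2r ?nnegrE ?expR_ge0 ?expR_ge1Dx// addr_ge0.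
  rewrite -expRM_natl ler_expR; have := h0 q; lra.
have EE : expR (1 - h q) = expR (31 * h q) * expR (1 - h j).
  by rewrite -expRD hE; congr expR; ring.
have E1 : 1 <= expR (1 - h j).
  rewrite -[leLHS]expR0 ler_expR subr_ge0 /h invf_le1 ?exprn_gt0//.
  by rewrite exprn_ege1// ler1n.
have E8' : (1 + h q) ^+ 8 <= expR (1 - h q).
  rewrite EE; apply: le_trans (_ : _ <= expR (31 * h q)) _; last first.
    by rewrite ler_peMr ?expR_ge0.
  by apply: le_trans E16; rewrite ler_weXn2l// lerDl.
have Y0 : 0 <= (2 ^+ q)^-1 :> R by pos.
have Y1 : (2 ^+ j)^-1 <= 1 :> R.
  by rewrite invf_le1 ?exprn_gt0// exprn_ege1// ler1n.
have -> : expR (1 - h q) * (2 + A * (1 - (2 ^+ q)^-1)) =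
   expR (31 * h q) * (expR (1 - h j) * (2 + A * (1 - (2 ^+ j)^-1)))
   + expR (1 - h q) * (A * (2 ^+ q)^-1).
  by rewrite EE twoE; ring.
apply: lerD; last by rewrite ler_wpM2r// mulr_ge0.
apply: ler_pM => //; first by pos.
rewrite /T; apply: sumr_ge0 => i _; rewrite mulr_ge0// energy_ge0//.
Qed.

End PlanarBound.

(** * Masses of tubes and slabs, and determinants *)

Section Scales.
Variable R : realType.
Implicit Types (m n e : nat) (s t : R).

Definition scale (n : nat) : R := (32 ^+ n)^-1.

Lemma scale_gt0 n : 0 < scale n.
Proof. by rewrite /scale invr_gt0 exprn_gt0. Qed.

Lemma scale_ge0 n : 0 <= scale n. Proof. exact/ltW/scale_gt0. Qed.

Lemma bucket_lt n t : 0 <= t <= 1 -> (Num.truncn (32 ^+ n * t) < (32 ^ n).+1)%N.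
Proof.
move=> /andP[t0 t1]; rewrite ltnS -(ler_nat R) natrX.
have h : 0 <= 32 ^+ n * t by pos.
have /andP[h1 _] := truncn_itv h; apply: le_trans h1 _.
by rewrite ler_piMr//; pos.
Qed.

Definition bucket n t : 'I_(32 ^ n).+1 := inord (Num.truncn (32 ^+ n * t)).

Lemma bucket_near n s t : 0 <= s <= 1 -> 0 <= t <= 1 ->
  bucket n s = bucket n t -> `|s - t| <= scale n.
Proof.
move=> s1 t1 /(congr1 val)/=; rewrite !inordK ?bucket_lt// => E.
have p0 : 0 < 32 ^+ n :> R by rewrite exprn_gt0.
have hs : 0 <= 32 ^+ n * s by case/andP: s1 => *; pos.
have ht : 0 <= 32 ^+ n * t by case/andP: t1 => *; pos.
have /andP[h1 h2] := truncn_itv hs; have /andP[h3 h4] := truncn_itv ht.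
rewrite /scale -[leRHS]mul1r ler_pdivlMr// -(gtr0_norm p0) -normrM ler_norml mulrBl.
move: h1 h2 h3 h4; rewrite E; move: (Num.truncn _) => T.
rewrite -(natr1 T) ![_ * 32 ^+ n]mulrC; move: (32 ^+ n * s) (32 ^+ n * t) => ps pt.
by move=> *; apply/andP; split; lra.
Qed.

Lemma exists_pow8 (A c : R) : 0 < c -> exists m, A / 8 ^+ m < c.
Proof.
move=> c0; pose m := (Num.truncn (`|A| / c)).+1.
exists m; rewrite ltr_pdivrMr ?exprn_gt0//.
apply: le_lt_trans (ler_norm A) _; rewrite mulrC -ltr_pdivrMr//.
apply: lt_le_trans (_ : m%:R <= _); first exact: truncnS_gt.
by rewrite -natrX ler_nat ltnW// ltn_expl.
Qed.

End Scales.

Definition coords_close (R : realType) (I : finType) (X Y Z : I -> R) (r : R) i i' :=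
  [&& `|X i' - X i| <= r, `|Y i' - Y i| <= r & `|Z i' - Z i| <= r].

Section Geometry.
Variable R : realType.
Variables (I : finType) (X Y Z w : I -> R) (k : nat).
Hypothesis X01 : forall i, 0 <= X i <= 1.
Hypothesis Y01 : forall i, 0 <= Y i <= 1.
Hypothesis Z01 : forall i, 0 <= Z i <= 1.
Hypothesis w0 : forall i, 0 <= w i.
Hypothesis w1 : \sum_i w i <= 1.
Local Notation close := (coords_close X Y Z).
Hypothesis ball : forall i n, (n <= k)%N ->
  \sum_(i' | close (scale R n) i i') w i' <= 27 / (2 ^+ 13) ^+ n.

Lemma scale_sub e n : (e <= n)%N -> 32 ^+ e * scale R n = scale R (n - e).
Proof.
move=> en; by rewrite /scale -{1}(subnK en) exprD invfM mulrCA mulfV ?mulr1// expf_eq0 pnatr_eq0 andbF.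
Qed.

Lemma sum_cond_le (P : pred I) : \sum_(i | P i) w i <= \sum_i w i.
Proof. by rewrite big_mkcond/=; apply: ler_sum => i _; case: ifP. Qed.

(** For [e <= n] this is [ball] at level [n - e]; for [e > n] the bound exceeds the
    total mass. *)
Lemma ball_mass i e n : (n <= k)%N ->
  \sum_(i' | close (32 ^+ e * scale R n) i i') w i' <= 27 * (2 ^+ 13) ^+ e / (2 ^+ 13) ^+ n.
Proof.
move=> nk; have [en|ne] := leqP e n.
  rewrite scale_sub//; apply: le_trans (ball _ _) _.
    by apply: leq_trans nk; rewrite leq_subr.
  rewrite -{2}(subnK en) exprD -mulrA ler_wpM2l//.
  by rewrite invfM mulrCA mulfV ?mulr1// !expf_eq0 pnatr_eq0 andbF.
apply: le_trans (sum_cond_le _) _; apply: le_trans w1 _.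
have p1 : 1 <= (2 : R) ^+ 13 by rewrite exprn_ege1// ler1n.
rewrite ler_pdivlMr ?mul1r; last by rewrite !exprn_gt0.
apply: (@le_trans _ _ ((2 ^+ 13) ^+ e)); first by rewrite (ler_weXn2l p1)// ltnW.
by rewrite ler_peMl ?ler1n//; pos.
Qed.

(** A set of points cut into parts of diameter at most [32^(e-n)] has at most the
    mass of one ball per part. *)
Lemma bucket_mass (P : pred I) (F : finType) (f : I -> F) e n : (n <= k)%N ->
  (forall i i', P i -> P i' -> f i = f i' -> close (32 ^+ e * scale R n) i i') ->
  \sum_(i | P i) w i <= #|F|%:R * (27 * (2 ^+ 13) ^+ e / (2 ^+ 13) ^+ n).
Proof.
move=> nk H; rewrite (partition_big f xpredT)//=.
have -> : #|F|%:R * (27 * (2 ^+ 13) ^+ e / (2 ^+ 13) ^+ n) =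
   \sum_(x : F) (27 * (2 ^+ 13) ^+ e / (2 ^+ 13) ^+ n) :> R.
  by rewrite sumr_const mulr_natl.
apply: ler_sum => x _.
have [i0 /andP[P0 /eqP f0]|none] := pickP (fun i => P i && (f i == x)); last first.
  by rewrite big_pred0//; pos.
apply: le_trans (ball_mass i0 e nk).
rewrite big_mkcond [leRHS]big_mkcond/=; apply: ler_sum => i _.
case: ifP => [/andP[Pi /eqP fi]|_]; last by case: ifP.
by rewrite (H i0 i P0 Pi)// f0 fi.
Qed.

Lemma card_bucket n : #|'I_(32 ^ n).+1|%:R <= 2 * 32 ^+ n :> R.
Proof. by rewrite card_ord -natr1 natrX mulr2n mulrDl !mul1r lerD2l exprn_ege1// ler1n. Qed.

(** One free coordinate: the set is covered by about [32^n] balls of radius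
    [32^(-n)], whence [2^(-13n) * 32^n = 256^(-n)]. *)
Lemma one_bucket_mass (P : pred I) (f : I -> R) e n : (n <= k)%N ->
  (forall i, 0 <= f i <= 1) ->
  (forall i i', P i -> P i' -> `|f i - f i'| <= scale R n ->
     close (32 ^+ e * scale R n) i i') ->
  \sum_(i | P i) w i <= 54 * (2 ^+ 13) ^+ e / 256 ^+ n.
Proof.
move=> nk f01 H.
apply: le_trans (bucket_mass nk (f := fun i => bucket n (f i)) _) _.
  by move=> i i' Pi Pi' /bucket_near => E; apply: H => //; exact: E.
apply: le_trans (ler_wpM2r _ (card_bucket n)) _; first by pos.
have -> : 2 ^+ 13 = 32 * 256 :> R by ring.
rewrite [(32 * 256) ^+ n]exprMn.
have : (256 : R) ^+ n != 0 by rewrite expf_eq0 pnatr_eq0 andbF.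
have : (32 : R) ^+ n != 0 by rewrite expf_eq0 pnatr_eq0 andbF.
move: (256 ^+ n) (32 ^+ n) ((32 * 256) ^+ e) => A B C A0 B0.
by rewrite le_eqVlt; apply/orP; left; apply/eqP; field; rewrite A0 B0.
Qed.

(** Two free coordinates: [2^(-13n) * 32^(2n) = 8^(-n)]. *)
Lemma two_bucket_mass (P : pred I) (f g : I -> R) e n : (n <= k)%N ->
  (forall i, 0 <= f i <= 1) -> (forall i, 0 <= g i <= 1) ->
  (forall i i', P i -> P i' -> `|f i - f i'| <= scale R n -> `|g i - g i'| <= scale R n ->
     close (32 ^+ e * scale R n) i i') ->
  \sum_(i | P i) w i <= 108 * (2 ^+ 13) ^+ e / 8 ^+ n.
Proof.
move=> nk f01 g01 H.
apply: le_trans (bucket_mass nk (f := fun i => (bucket n (f i), bucket n (g i))) _) _.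
  move=> i i' Pi Pi' [/bucket_near E1 /bucket_near E2].
  by apply: H => //; [exact: E1|exact: E2].
rewrite card_prod natrM.
have cb : #|'I_(32 ^ n).+1|%:R * #|'I_(32 ^ n).+1|%:R <= (2 * 32 ^+ n) * (2 * 32 ^+ n) :> R.
  by apply: ler_pM => //; exact: card_bucket.
apply: le_trans (ler_wpM2r _ cb) _; first by pos.
have -> : 2 ^+ 13 = 32 * 32 * 8 :> R by ring.
rewrite [(32 * 32 * 8) ^+ n]exprMn [(32 * 32) ^+ n]exprMn.
have : (8 : R) ^+ n != 0 by rewrite expf_eq0 pnatr_eq0 andbF.
have : (32 : R) ^+ n != 0 by rewrite expf_eq0 pnatr_eq0 andbF.
move: (8 ^+ n) (32 ^+ n) ((32 * 32 * 8) ^+ e) => A B C A0 B0.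
by rewrite le_eqVlt; apply/orP; left; apply/eqP; field; rewrite A0 B0.
Qed.

(** The slab of points whose third coordinate is small cannot carry the whole
    mass. *)
Lemma exists_high m0 : (m0 <= k)%N -> 108 / 8 ^+ m0 < \sum_i w i ->
  exists i, scale R m0 <= Z i.
Proof.
move=> mk big; apply: contrapT => /forallNP low.
have {}low i : Z i < scale R m0 by rewrite ltNge; exact/negP/low.
move: big; rewrite ltNge => /negP; apply.
have := @two_bucket_mass xpredT X Y 0 m0 mk X01 Y01.
rewrite expr0 mulr1; apply => i i' _ _; rewrite mul1r distrC => xx.
rewrite distrC => yy; rewrite /coords_close xx yy/= ler_norml.
have := low i; have := low i'; have /andP[] := Z01 i; have /andP[] := Z01 i'.
by move=> *; apply/andP; split; lra.
Qed.

Section Projection.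
Variables (i1 : I) (m0 : nat).
Hypothesis high : scale R m0 <= Z i1.

(** The coordinates of the projection along the point [i1] onto the plane [Z = 0]. *)
Definition projX i := X i - X i1 / Z i1 * Z i.
Definition projY i := Y i - Y i1 / Z i1 * Z i.

Let P : R := 32 ^+ m0.

Lemma max_slope_ge1 : 1 <= P. Proof. by rewrite exprn_ege1// ler1n. Qed.

Lemma pivot_gt0 : 0 < Z i1. Proof. exact: lt_le_trans (scale_gt0 R m0) high. Qed.

Lemma slope_bound (u : R) : 0 <= u <= 1 -> 0 <= u / Z i1 <= P.
Proof.
move=> /andP[u0 u1]; have z0 := pivot_gt0.
rewrite divr_ge0 ?(ltW z0)//= ler_pdivrMr//.
apply: le_trans u1 _; have := ler_wpM2l (le_trans ler01 max_slope_ge1) high.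
by rewrite /P /scale mulfV// expf_eq0 pnatr_eq0 andbF.
Qed.

Lemma shear_bound (p u z : R) : 0 <= p <= P -> 0 <= u <= 1 -> 0 <= z <= 1 ->
  `|u - p * z| <= P.
Proof.
have := max_slope_ge1; move: P => Q Q1 /andP[p0 pP] /andP[u0 u1] /andP[z0 z1].
have : 0 <= p * z by pos.
have : p * z <= Q by nra.
by move=> *; rewrite ler_norml; apply/andP; split; lra.
Qed.

Lemma projX_bound i : `|projX i| <= P.
Proof. by apply: shear_bound => //; exact: slope_bound. Qed.

Lemma projY_bound i : `|projY i| <= P.
Proof. by apply: shear_bound => //; exact: slope_bound. Qed.

Lemma unshear_dist (p u u' z z' r s : R) : 0 <= p <= P ->
  `|(u - p * z) - (u' - p * z')| <= r -> `|z - z'| <= s ->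
  `|u - u'| <= r + P * s.
Proof.
move=> /andP[p0 pP] h1 h2.
have -> : u - u' = ((u - p * z) - (u' - p * z')) + p * (z - z') by ring.
apply: le_trans (ler_normD _ _) _; apply: lerD => //.
by rewrite normrM (ger0_norm p0); apply: ler_pM.
Qed.

(** The points with [|projX|] small lie in a slab around a plane through the
    point [i1]; discarding them keeps the slopes [projY / projX] bounded. *)
Lemma small_projX_mass m1 : (m1 <= k)%N ->
  \sum_(i | `|projX i| < scale R m1) w i <= 108 * (2 ^+ 13) ^+ m0.+1 / 8 ^+ m1.
Proof.
move=> mk; apply: (two_bucket_mass (f := Y) (g := Z)) => // i i' ai ai' yy zz.
have s0 := scale_ge0 R m1; have p1 := max_slope_ge1.
have bigE : scale R m1 <= 32 ^+ m0.+1 * scale R m1.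
  by rewrite ler_peMl// exprn_ege1// ler1n.
rewrite /coords_close distrC [`|Y i' - _|]distrC [`|Z i' - _|]distrC.
rewrite (le_trans yy bigE) (le_trans zz bigE) !andbT.
have h : `|projX i - projX i'| <= 2 * scale R m1.
  by apply: le_trans (ler_normB _ _) _; move: (ltW ai) (ltW ai'); lra.
apply: le_trans (unshear_dist (slope_bound (X01 i1)) h zz) _.
rewrite exprS -/P; move: (scale R m1) s0 => s s0; nra.
Qed.

(** Points with nearby projections lie in a tube parallel to the point [i1]; along it
    the third coordinate is free. *)
Lemma tube_mass i0 n h : (n <= k)%N ->
  \sum_(i | (`|projX i0 - projX i| <= 32 ^+ h * scale R n) &&
            (`|projY i0 - projY i| <= 32 ^+ h * scale R n)) w i
    <= 54 * (2 ^+ 13) ^+ (h + m0).+1 / 256 ^+ n.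
Proof.
move=> nk; apply: (one_bucket_mass (f := Z)) => // i i' /andP[ai bi] /andP[ai' bi'] zz.
have s0 := scale_ge0 R n; have p1 := max_slope_ge1.
have H1 : 1 <= (32 : R) ^+ h by rewrite exprn_ege1// ler1n.
have far (x x0 x' : R) : `|x0 - x| <= 32 ^+ h * scale R n -> `|x0 - x'| <= 32 ^+ h * scale R n ->
    `|x - x'| <= 2 * (32 ^+ h * scale R n).
  by rewrite (distrC x0) => h1 h2; apply: le_trans (ler_distD x0 _ _) _; lra.
rewrite /coords_close distrC [`|Y i' - _|]distrC [`|Z i' - _|]distrC.
have E : 32 ^+ (h + m0).+1 * scale R n = 32 * (32 ^+ h * scale R n * P).
  by rewrite exprS exprD /P; ring.
have hs : scale R n <= 32 ^+ h * scale R n by rewrite ler_peMl.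
rewrite E; set r := 32 ^+ h * scale R n in hs ai bi ai' bi' far *.
clearbody r; move: (scale R n) s0 hs zz => s s0 hs zz.
have rP : r <= r * P by rewrite ler_peMr// (le_trans s0 hs).
have sP : P * s <= r * P by rewrite mulrC ler_wpM2r// (le_trans ler01 p1).
have r0 : 0 <= r by exact: le_trans hs.
have ha : `|projX i - projX i'| <= 2 * r := far _ _ _ ai ai'.
have hb : `|projY i - projY i'| <= 2 * r := far _ _ _ bi bi'.
apply/and3P; split.
- by apply: le_trans (unshear_dist (slope_bound (X01 i1)) ha zz) _; lra.
- by apply: le_trans (unshear_dist (slope_bound (Y01 i1)) hb zz) _; lra.
- by apply: le_trans zz _; lra.
Qed.

(** Points of slope close to [t] lie in a slab around a plane; the coefficient of [Y]
    in its equation is 1, so [X] and [Z] are free and determine [Y]. *)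
Lemma slab_mass t g m : (m <= k)%N -> `|t| <= 32 ^+ g ->
  \sum_(i | `|projY i - t * projX i| <= 32 ^+ g * P * scale R m) w i
    <= 108 * (2 ^+ 13) ^+ (g + m0).+1 / 8 ^+ m.
Proof.
move=> mk tG; apply: (two_bucket_mass (f := X) (g := Z)) => // i i' hi hi' xx zz.
have s0 := scale_ge0 R m; have p1 := max_slope_ge1.
have G1 : 1 <= (32 : R) ^+ g by rewrite exprn_ege1// ler1n.
have E : 32 ^+ (g + m0).+1 * scale R m = 32 * (32 ^+ g * P * scale R m).
  by rewrite exprS exprD /P; ring.
rewrite /coords_close distrC [`|Y i' - _|]distrC [`|Z i' - _|]distrC E.
have /andP[px0 px1] := slope_bound (X01 i1).
have ha : `|projX i - projX i'| <= 2 * P * scale R m.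
  have -> : projX i - projX i' = (X i - X i') - X i1 / Z i1 * (Z i - Z i').
    by rewrite /projX; ring.
  apply: le_trans (ler_normB _ _) _; rewrite normrM (ger0_norm px0).
  have : X i1 / Z i1 * `|Z i - Z i'| <= P * scale R m by apply: ler_pM.
  have : scale R m <= P * scale R m by rewrite ler_peMl.
  lra.
have hb : `|projY i - projY i'| <= 4 * (32 ^+ g * P * scale R m).
  have -> : projY i - projY i' = ((projY i - t * projX i) - (projY i' - t * projX i')) + t * (projX i - projX i').
    by ring.
  apply: le_trans (ler_normD _ _) _; rewrite normrM.
  have := ler_normB (projY i - t * projX i) (projY i' - t * projX i').
  have : `|t| * `|projX i - projX i'| <= 32 ^+ g * (2 * P * scale R m) by apply: ler_pM.
  lra.
have PG : P * scale R m <= 32 ^+ g * P * scale R m.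
  by rewrite -mulrA ler_peMl// mulr_ge0// (le_trans ler01 p1).
have sP : scale R m <= P * scale R m by rewrite ler_peMl.
apply/and3P; split; [| |].
- by apply: le_trans xx _; lra.
- by apply: le_trans (unshear_dist (slope_bound (Y01 i1)) hb zz) _; lra.
- by apply: le_trans zz _; lra.
Qed.

End Projection.

(** The determinant of the points of indices [i1], [i2], [i]. *)
Definition det3 i1 i2 i := X i1 * (Y i2 * Z i - Z i2 * Y i)
  - X i2 * (Y i1 * Z i - Z i1 * Y i) + X i * (Y i1 * Z i2 - Z i1 * Y i2).

Lemma det3_proj i1 i2 i i' : Z i1 != 0 ->
  det3 i1 i2 i - det3 i1 i2 i' =
  Z i1 * (projX i1 i2 * (projY i1 i - projY i1 i') - projY i1 i2 * (projX i1 i - projX i1 i')).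
Proof. by move=> z0; rewrite /det3 /projX /projY; field. Qed.

Definition frostman_const (m0 m1 : nat) : R :=
  54 * (2 ^+ 13) ^+ (((m0 + m1).+1 + m0).+1 + m0).+1
  + 108 * (2 ^+ 13) ^+ ((m0 + m1).+1 + m0).+1.

Definition energy_const (m0 m1 : nat) : R :=
  expR 1 * (2 + 200 * 2 * 32 ^+ 8 * frostman_const m0 m1 ^+ 2).

(** [m0] and [m1] bound from below the third coordinate of the first point and
    [|projX|] of the second one.  The factors [32 ^+ g] and [32 ^+ h] bring the
    slopes and the projected points into the range of [planar_energy_bound].  That
    result bounds the energy on average over slopes, so some slope, that is
    some second point, has bounded energy. *)
Lemma det_energy_bound c0 m0 m1 K : 0 < c0 -> c0 <= \sum_i w i ->
  108 / 8 ^+ m0 < c0 -> 108 * (2 ^+ 13) ^+ m0.+1 / 8 ^+ m1 < c0 / 2 ->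
  (4 * K + (m0 + m1) <= k)%N ->
  exists i1 i2, \sum_i \sum_i' (if `|det3 i1 i2 i - det3 i1 i2 i'| <= scale R (3 * K)
     then w i * w i' else 0) <= 4 * energy_const m0 m1 / c0 * scale R (3 * K).
Proof.
move=> c00 cw hm0 hm1 kK.
have m0k : (m0 <= k)%N.
  by apply: leq_trans kK; rewrite addnCA leq_addr.
have m1k : (m1 <= k)%N by apply: leq_trans kK; rewrite addnA leq_addl.
have fK n : (n <= 4 * K)%N -> (n <= k)%N.
  by move=> nK; apply: leq_trans kK; rewrite (leq_trans nK)// leq_addr.
set g := (m0 + m1).+1; set h := (g + m0).+1.
set C := frostman_const m0 m1; set Q := energy_const m0 m1.
have T0 e : 0 <= ((2 : R) ^+ 13) ^+ e by pos.
have CE1 : 54 * (2 ^+ 13) ^+ (h + m0).+1 <= C.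
  by rewrite /C /frostman_const lerDl; apply: mulr_ge0.
have CE2 : 108 * (2 ^+ 13) ^+ (g + m0).+1 <= C.
  by rewrite /C /frostman_const lerDr; apply: mulr_ge0.
have C0 : 0 <= C by apply: le_trans CE1; apply: mulr_ge0.
have QE : expR 1 * (2 + 200 * 2 * 32 ^+ 8 * C ^+ 2) = Q by [].
have Q0 : 0 <= Q.
  rewrite -QE; apply: mulr_ge0; first exact: expR_ge0.
  by apply: addr_ge0; [pos|apply: mulr_ge0; [pos|exact: sqr_ge0]].
move: C Q CE1 CE2 C0 QE Q0 => C Q CE1 CE2 C0 QE Q0.
have [i1 high] := exists_high m0k (lt_le_trans hm0 cw).
exists i1; pose a := projX i1; pose b := projY i1.
have z0 := pivot_gt0 high.
pose ok i := scale R m1 <= `|a i|.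
pose nu i := if ok i then w i else 0.
pose th i := if ok i then b i / a i / 32 ^+ g else 0.
pose a' i := 32 ^+ g / 32 ^+ h * a i.
pose b' i := b i / 32 ^+ h.
have p32 n : 0 < (32 : R) ^+ n by rewrite exprn_gt0.
have n32 n : (32 : R) ^+ n != 0 by rewrite gt_eqF.
have nu0 i : 0 <= nu i by rewrite /nu; case: ifP.
have nu1 : \sum_i nu i <= 1.
  by apply: le_trans w1; apply: ler_sum => i _; rewrite /nu; case: ifP.
have nuc : c0 / 2 <= \sum_i nu i.
  have : \sum_i w i = \sum_i nu i + \sum_(i | `|a i| < scale R m1) w i.
    rewrite [X in _ + X]big_mkcond -big_split/=; apply: eq_bigr => i _.
    by rewrite /nu /ok; case: ltP; rewrite ?addr0 ?add0r.
  have := small_projX_mass high m1k; rewrite -/a; lra.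
have thb i : `|th i| <= 32^-1.
  rewrite /th; case: ifP => [oki|_]; last by rewrite normr0 invr_ge0.
  have ai : 0 < `|a i| by apply: lt_le_trans oki; exact: scale_gt0.
  rewrite !normrM !normfV (gtr0_norm (p32 _)) ler_pdivrMr// ler_pdivrMr//.
  rewrite /g exprS mulrA mulVf ?pnatr_eq0// mul1r exprD.
  apply: le_trans (projY_bound high i) _.
  rewrite -mulrA ler_peMr ?(ltW (p32 _))//.
  have := ler_wpM2l (ltW (p32 m1)) oki.
  by rewrite /scale mulfV.
have th1 i : -1 <= th i < 1.
  have : (32 : R)^-1 < 1 by rewrite invf_lt1// ltr1n.
  by have := thb i; rewrite ler_norml => /andP[? ?] ?; apply/andP; split; lra.
have hE : (32 : R) ^+ h = 32 * (32 ^+ g * 32 ^+ m0) by rewrite /h exprS exprD.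
have G1 n : 1 <= (32 : R) ^+ n by rewrite exprn_ege1// ler1n.
have a'E i i' : `|a' i - a' i'| = 32 ^+ g / 32 ^+ h * `|a i - a i'|.
  by rewrite /a' -mulrBr normrM ger0_norm//; pos.
have b'E i i' : `|b' i - b' i'| = `|b i - b i'| / 32 ^+ h.
  by rewrite /b' -mulrBl normrM normfV (gtr0_norm (p32 _)).
have a1 i i' : `|a' i - a' i'| <= 1.
  rewrite a'E mulrAC ler_pdivrMr// mul1r hE.
  have : `|a i - a i'| <= 2 * 32 ^+ m0.
    apply: le_trans (ler_normB _ _) _.
    by have := projX_bound high i; have := projX_bound high i'; rewrite -/a; lra.
  by have := p32 m0; have := p32 g; move: (32 ^+ g) (32 ^+ m0) => *; nra.
have b1 i i' : `|b' i - b' i'| <= 1.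
  rewrite b'E ler_pdivrMr// mul1r hE.
  have : `|b i - b i'| <= 2 * 32 ^+ m0.
    apply: le_trans (ler_normB _ _) _.
    by have := projY_bound high i; have := projY_bound high i'; rewrite -/b; lra.
  by have := p32 m0; have := G1 g; move: (32 ^+ g) (32 ^+ m0) => *; nra.
have ballC i n : (n <= 3 * K)%N ->
  \sum_(i' | (`|a' i - a' i'| <= (32 ^+ n)^-1) && (`|b' i - b' i'| <= (32 ^+ n)^-1)) w i'
    <= C / 256 ^+ n.
  move=> nK; have nk : (n <= k)%N by apply: fK; rewrite (leq_trans nK)// leq_mul2r orbT.
  apply: (@le_trans _ _ (54 * (2 ^+ 13) ^+ (h + m0).+1 / 256 ^+ n)); last first.
    by apply: ler_wpM2r; [by pos|exact: CE1].
  apply: le_trans (tube_mass high i h nk).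
  rewrite big_mkcond [leRHS]big_mkcond/=; apply: ler_sum => i' _.
  case: ifP => [/andP[ha hb]|_]; last by case: ifP.
  rewrite ifT//; rewrite a'E b'E in ha hb; apply/andP; split.
    move: ha; rewrite mulrAC ler_pdivrMr// -/(scale R n) mulrC.
    rewrite [leRHS]mulrC; apply: le_trans.
    by rewrite -/a ler_peMr.
  by move: hb; rewrite ler_pdivrMr// mulrC.
have arcC j m : (m <= 4 * K)%N ->
  \sum_(j' | `|th j' - th j| <= (32 ^+ m)^-1) nu j' <= C / 8 ^+ m.
  move=> mK; have mk : (m <= k)%N by exact: fK.
  apply: (@le_trans _ _ (108 * (2 ^+ 13) ^+ (g + m0).+1 / 8 ^+ m)); last first.
    by apply: ler_wpM2r; [by pos|exact: CE2].
  pose t := 32 ^+ g * th j.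
  have tg : `|t| <= 32 ^+ g.
    rewrite normrM (gtr0_norm (p32 _)) ler_piMr ?(ltW (p32 _))//.
    by have := th1 j; rewrite ler_norml => /andP[-> /ltW].
  apply: le_trans (slab_mass high mk tg).
  rewrite big_mkcond [leRHS]big_mkcond/=; apply: ler_sum => i _.
  rewrite /nu; case: ifP => [hi|_]; last by case: ifP.
  case: ifP => [oki|_]; last by case: ifP.
  rewrite ifT//; move: hi; rewrite /th oki -/(scale R m) -/(th j) -/a -/b.
  have ai : a i != 0.
    by apply: contraTN oki => /eqP ai; rewrite /ok ai normr0 -ltNge scale_gt0.
  have -> : b i - t * a i = 32 ^+ g * a i * (b i / a i / 32 ^+ g - th j).
    by rewrite /t; field; rewrite ai n32.
  move=> hi; rewrite !normrM (gtr0_norm (p32 _)).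
  apply: ler_pM; rewrite ?mulr_ge0 ?(ltW (p32 _))//.
  by rewrite ler_wpM2l ?(ltW (p32 _))//; exact: projX_bound.
have main := planar_energy_bound w0 nu0 w1 nu1 th1 a1 b1 C0 ballC arcC.
rewrite QE -/(scale R (3 * K)) in main.
set d := scale R (3 * K) in main *.
have d0 : 0 < d by exact: scale_gt0.
have [j [okj Ej]] : exists j, ok j /\ energy w a' b' d (th j) <= 2 * Q / c0.
  apply: contrapT => /forallNP none.
  have {}none j : ok j -> 2 * Q / c0 < energy w a' b' d (th j).
    by move=> okj; rewrite ltNge; apply/negP => H; apply: (none j).
  have : \sum_j nu j * (energy w a' b' d (th j) - 2 * Q / c0) <= 0.
    under eq_bigr do rewrite mulrBr.
    rewrite sumrB -mulr_suml subr_le0; apply: le_trans main _.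
    apply: le_trans (_ : c0 / 2 * (2 * Q / c0) <= _).
      by rewrite le_eqVlt; apply/orP; left; apply/eqP; field; rewrite gt_eqF.
    by rewrite ler_wpM2r// divr_ge0// ?mulr_ge0// ltW.
  rewrite leNgt => /negP; apply.
  have t0 j : 0 <= nu j * (energy w a' b' d (th j) - 2 * Q / c0).
    rewrite /nu; case: ifP => [oj|_]; last by rewrite mul0r.
    by rewrite mulr_ge0// subr_ge0 ltW// none.
  rewrite lt_neqAle sumr_ge0// andbT eq_sym; apply/negP => /eqP s0.
  have {}s0 j : nu j = 0.
    have /(_ j isT)/eqP := psumr_eq0P (fun j _ => t0 j) s0.
    rewrite mulf_eq0 => /orP[/eqP//|/eqP e0]; rewrite /nu; case: ifP => // oj.
    by have := none j oj; rewrite -subr_gt0 e0 ltxx.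
  by move: nuc; rewrite big1 => // nuc; lra.
exists j.
apply: (@le_trans _ _ (2 * d * energy w a' b' d (th j))); last first.
  apply: le_trans (ler_wpM2l _ Ej) _; first by pos.
  by rewrite le_eqVlt; apply/orP; left; apply/eqP; ring.
rewrite /energy mulr_sumr; apply: ler_sum => i _.
rewrite mulr_sumr; apply: ler_sum => i' _.
case: ifP => [hD|_]; last first.
  by apply: mulr_ge0; [pos|apply: mulr_ge0; [exact: mulr_ge0|exact: kern_ge0]].
set u := _ - _ * _.
(* The difference of the determinants is [u] times a factor of modulus at least 1. *)
suff ud : `|u| <= d.
  rewrite mulrCA ler_peMr ?mulr_ge0//.
  by rewrite -ler_pdivrMl ?mulr_gt0// mulr1; exact: kern_near.
apply: le_trans hD; rewrite (det3_proj _ _ _ (lt0r_neq0 z0)) -/a -/b.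
have aj : a j != 0.
  by apply: contraTN okj => /eqP ai; rewrite /ok ai normr0 -ltNge scale_gt0.
have -> : Z i1 * (a j * (b i - b i') - b j * (a i - a i')) = Z i1 * a j * 32 ^+ h * u.
  by rewrite /u /a' /b' /th okj; field; rewrite aj !n32.
rewrite (normrM _ u) ler_peMl// (normrM _ (32 ^+ h)) (normrM (Z i1)).
rewrite (gtr0_norm (p32 _)) (gtr0_norm z0).
apply: (@le_trans _ _ (scale R m0 * scale R m1 * 32 ^+ h)).
  rewrite hE /g [32 ^+ (m0 + m1).+1]exprS exprD /scale.
  have -> : (32 ^+ m0)^-1 * (32 ^+ m1)^-1 *
     (32 * (32 * (32 ^+ m0 * 32 ^+ m1) * 32 ^+ m0)) = 32 * 32 * 32 ^+ m0 :> R.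
    by field; rewrite !n32.
  by have := G1 m0; lra.
by rewrite ler_wpM2r ?(ltW (p32 _))//; apply: ler_pM; rewrite ?scale_ge0.
Qed.
End Geometry.

(** * From bounded energy to length *)

Section Discrete.
Variable R : realType.

Lemma discrete_det_energy (c0 : R) : 0 < c0 -> exists k0 (M : R), 0 < M /\
  forall K (I : finType) (X Y Z w : I -> R),
    (forall i, 0 <= X i <= 1) -> (forall i, 0 <= Y i <= 1) ->
    (forall i, 0 <= Z i <= 1) -> (forall i, 0 <= w i) ->
    \sum_i w i <= 1 -> c0 <= \sum_i w i ->
    (forall i n, (n <= 4 * K + k0)%N ->
       \sum_(i' | coords_close X Y Z (scale R n) i i') w i' <= 27 / (2 ^+ 13) ^+ n) ->
  exists i1 i2, \sum_i \sum_i'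
    (if `|det3 X Y Z i1 i2 i - det3 X Y Z i1 i2 i'| <= scale R (3 * K)
     then w i * w i' else 0) <= M * scale R (3 * K).
Proof.
move=> c00; have [m0 hm0] := exists_pow8 108 c00.
have c02 : 0 < c0 / 2 by rewrite divr_gt0.
have [m1 hm1] := exists_pow8 (108 * (2 ^+ 13) ^+ m0.+1) c02.
have E0 : 0 <= energy_const R m0 m1.
  apply: mulr_ge0; first exact: expR_ge0.
  by apply: addr_ge0 => //; apply: mulr_ge0; [pos|exact: sqr_ge0].
exists (m0 + m1)%N, (4 * energy_const R m0 m1 / c0 + 1); split.
  by apply: ltr_wpDl => //; rewrite divr_ge0 ?(ltW c00)//; apply: mulr_ge0.
move=> K I X Y Z w X01 Y01 Z01 w0 w1 cw ball.
have [i1 [i2 H]] := det_energy_bound X01 Y01 Z01 w0 w1 ball c00 cw hm0 hm1 (leqnn _).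
exists i1, i2; apply: le_trans H _; rewrite ler_wpM2r ?scale_ge0//.
by rewrite lerDl.
Qed.

Definition grid_cell (d : R) (f : int) : set R := `[f%:~R * d, (f + 1)%:~R * d[%classic.

Lemma lebesgue_grid (d : R) (s : seq int) : 0 < d -> uniq s ->
  lebesgue_measure (\bigcup_(f in [set` s]) grid_cell d f)
    = ((size s)%:R * d)%:E.
Proof.
move=> d0 us; rewrite /grid_cell.
have mu1 f : lebesgue_measure (`[f%:~R * d, (f + 1)%:~R * d[%classic : set R) = d%:E.
  rewrite lebesgue_measure_itv/= lte_fin ltr_pM2r// ltr_int ltzD1 lexx.
  by rewrite EFinN -EFinB -mulrBl intrD addrAC subrr add0r mul1r.
rewrite measure_fin_bigcup//=.
- rewrite (eq_fsbigr (fun=> d%:E)); last by move=> f _; exact: mu1.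
  rewrite -fsbig_seq// sumEFin big_const_seq count_predT iter_addr_0.
  by rewrite mulr_natl.
- apply/trivIsetP => f g _ _ fg; rewrite -subset0 => x /= [].
  rewrite !in_itv/= => /andP[f1 f2] /andP[g1 g2]; move/negP: fg; apply.
  have lt h h' : h%:~R * d <= x -> x < (h' + 1)%:~R * d -> h <= h'.
    move=> h1 h2; have := le_lt_trans h1 h2.
    by rewrite ltr_pM2r// ltr_int ltzD1.
  by rewrite eq_le (lt _ _ f1 g2) (lt _ _ g1 f2).
Qed.

(** Let [W_g] be the mass of the values in the cell [g] of length [d].  The squares
    [W_g^2] sum up to at most [M d], so by Cauchy-Schwarz [c0^2 <= n * M d] for the
    number [n] of occupied cells, whose total length is [n d]. *)
Lemma occupied_cells (I : finType) (w D : I -> R) (c0 M d : R) :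
  0 < d -> 0 < c0 -> 0 < M -> (forall i, 0 <= w i) -> c0 <= \sum_i w i ->
  \sum_i \sum_i' (if `|D i - D i'| <= d then w i * w i' else 0) <= M * d ->
  ((c0 ^+ 2 / M)%:E <= lebesgue_measure (\bigcup_i grid_cell d (Num.floor (D i / d))))%E.
Proof.
move=> d0 c00 M0 w0 cw HM.
pose f i := Num.floor (D i / d).
pose s := undup [seq f i | i : I].
have fs i : f i \in s by rewrite mem_undup map_f// mem_enum.
have -> : \bigcup_i grid_cell d (Num.floor (D i / d)) = \bigcup_(g in [set` s]) grid_cell d g.
  apply/seteqP; split=> [x [i _ ix]|x [g /= gs gx]].
    by exists (f i) => //=; exact: fs.
  by move: gs; rewrite mem_undup => /mapP[i _ gE]; exists i => //; rewrite gE in gx.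
rewrite (lebesgue_grid d0 (undup_uniq _)) lee_fin -/s.
pose W g := \sum_(i | f i == g) w i.
have SW : \sum_(g <- s) W g = \sum_i w i.
  rewrite /W (exchange_big_dep xpredT)//=; apply: eq_bigr => i _.
  rewrite (big_rem (f i) (fs i))/= eqxx.
  rewrite big1_seq ?addr0// => g /andP[/eqP fg].
  by rewrite mem_rem_uniq ?undup_uniq// inE fg eqxx.
have SW2 : \sum_(g <- s) W g ^+ 2 <= M * d.
  apply: le_trans HM.
  have -> : \sum_(g <- s) W g ^+ 2 = \sum_i w i * W (f i).
    rewrite (eq_bigr (fun g => \sum_(i | f i == g) w i * W (f i))); last first.
      move=> g _; rewrite expr2 {1}/W mulr_suml; apply: eq_bigr => i /eqP->//.
    rewrite (exchange_big_dep xpredT)//=; apply: eq_bigr => i _.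
    rewrite (big_rem (f i) (fs i))/= eqxx.
    rewrite big1_seq ?addr0// => g /andP[/eqP fg].
    by rewrite mem_rem_uniq ?undup_uniq// inE fg eqxx.
  apply: ler_sum => i _; rewrite /W mulr_sumr big_mkcond/=; apply: ler_sum => i' _.
  case: eqP => [ff|_]; last by case: ifP => // _; exact: mulr_ge0.
  rewrite ifT//.
  have /andP[a1 a2] := floor_itv (D i / d).
  have /andP[b1 b2] := floor_itv (D i' / d).
  rewrite -/(f i) -/(f i') ff in a1 a2 b1 b2.
  rewrite !ler_pdivlMr// !ltr_pdivrMr// in a1 a2 b1 b2.
  rewrite intrD mulrDl mul1r in a2 b2.
  by rewrite ler_norml; move: (_ * d) a1 a2 b1 b2 => F *; apply/andP; split; lra.
set n : R := (size s)%:R; set S := \sum_i w i in cw SW.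
(* Cauchy-Schwarz in the form [(W g - t)^2 >= 0], used below with [t = S / n]. *)
have key t : 2 * t * S - t ^+ 2 * n <= M * d.
  apply: le_trans SW2; rewrite -SW mulr_sumr.
  have -> : t ^+ 2 * n = \sum_(g <- s) t ^+ 2.
    by rewrite big_const_seq count_predT iter_addr_0 mulr_natr.
  rewrite -sumrB; apply: ler_sum => g _.
  have := sqr_ge0 (W g - t); nra.
have S0 : 0 < S by exact: lt_le_trans cw.
have n0 : 0 < n.
  rewrite lt_neqAle ler0n andbT; apply/negP => /eqP n0.
  have := key ((M * d + 1) / S); rewrite -n0 mulr0 subr0 mulrA -mulrA mulVf ?gt_eqF//.
  have : 0 < M * d by rewrite mulr_gt0.
  lra.
have := key (S / n).
have -> : 2 * (S / n) * S - (S / n) ^+ 2 * n = S ^+ 2 / n by field; rewrite gt_eqF.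
rewrite ler_pdivrMr// ler_pdivrMr// => H.
apply: (@le_trans _ _ (S ^+ 2)); first by rewrite lerXn2r ?nnegrE ?(ltW c00) ?(ltW S0).
by apply: le_trans H _; rewrite le_eqVlt; apply/orP; left; apply/eqP; ring.
Qed.

End Discrete.

(** * Content by cells *)

Section Content.
Variable R : realType.
Variables (X : choiceType) (T : countType) (cell : nat -> X -> T).
Variables (rho : R) (t0 : T).
Hypothesis rho0 : 0 < rho.
Hypothesis rho1 : rho <= 1.
Hypothesis cell0 : forall x, cell 0 x = t0.
Hypothesis refine : forall n x y, cell n.+1 x = cell n.+1 y -> cell n x = cell n y.

Let Q (q : nat * T) : set X := [set x | cell q.1 x = q.2].
Implicit Types (S : set (nat * T)) (A B : set X) (s : seq (nat * T)).

Lemma refine_le m n x y : (m <= n)%N -> cell n x = cell n y -> cell m x = cell m y.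
Proof.
move=> /subnK <-; elim: (n - m)%N => // k IH; rewrite addSn => /refine; exact: IH.
Qed.

Definition covers S A := forall x, A x -> exists n, S (n, cell n x).
(** The infinite sum of the weights of the cells of [S] is at most [c]. *)
Definition cost_le S (c : R) :=
  forall s, uniq s -> (forall q, q \in s -> S q) -> \sum_(q <- s) rho ^+ q.1 <= c.
Definition cell_content A : R := inf [set c | exists2 S, covers S A & cost_le S c].

Lemma rhoX_ge0 n : 0 <= rho ^+ n. Proof. by rewrite exprn_ge0// ltW. Qed.

Lemma cost_le_ge0 S c : cost_le S c -> 0 <= c.
Proof. by move=> /(_ [::] isT); rewrite big_nil; apply. Qed.

Lemma cost_cell q : cost_le [set q] (rho ^+ q.1).
Proof.
move=> s us sq.
have [->|[p ps]] : s = [::] \/ exists p, p \in s.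
- by case: s {us sq} => [|p s]; [left|right; exists p; rewrite mem_head].
- by rewrite big_nil rhoX_ge0.
rewrite (big_rem p ps)/= big1_seq ?addr0; first by rewrite (sq p ps).
move=> r /=; rewrite mem_rem_uniq// inE => /andP[rp rs].
by move: rp; rewrite (sq r rs) (sq p ps) eqxx.
Qed.

Lemma content_le S A c : covers S A -> cost_le S c -> cell_content A <= c.
Proof.
move=> SA Sc; apply: ge_inf; last by exists S.
by exists 0 => d [? _ /cost_le_ge0].
Qed.

Lemma content_cell A q : A `<=` Q q -> cell_content A <= rho ^+ q.1.
Proof.
move=> AQ; apply: (content_le (S := [set q])); last exact: cost_cell.
by move=> x /AQ xq; exists q.1 => /=; rewrite xq; case: q {AQ xq}.
Qed.

Lemma content_has_inf A : has_inf [set c | exists2 S, covers S A & cost_le S c].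
Proof.
split; last by exists 0 => d [? _ /cost_le_ge0].
exists (rho ^+ 0), [set (0%N, t0)]; last exact: (@cost_cell (0%N, t0)).
by move=> x _; exists 0%N; rewrite cell0.
Qed.

Lemma content_ge0 A : 0 <= cell_content A.
Proof.
apply: lb_le_inf; first by case: (content_has_inf A).
by move=> c [? _ /cost_le_ge0].
Qed.

Lemma content_adherent A e : 0 < e -> exists2 S, covers S A & cost_le S (cell_content A + e).
Proof.
move=> e0; have [c [S SA Sc] ce] := inf_adherent e0 (content_has_inf A).
exists S => // s us sS; apply: le_trans (ltW ce); exact: Sc.
Qed.

Lemma content_mono A B : A `<=` B -> cell_content A <= cell_content B.
Proof.
move=> AB; apply/ler_addgt0Pr => e e0.
have [S SB Sc] := content_adherent B e0.
by apply: content_le Sc => x /AB/SB.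
Qed.

Lemma content0 : cell_content set0 = 0.
Proof.
apply/eqP; rewrite eq_le content_ge0 andbT; apply: (content_le (S := set0)) => //.
by case=> [_ _|q s _ /(_ q)]; [rewrite big_nil|rewrite mem_head => /(_ isT)].
Qed.

(** A finite subfamily of the union only involves finitely many of the [S i]. *)
Lemma cost_bigcup (S : nat -> set (nat * T)) (c : nat -> R) C :
  (forall i, cost_le (S i) (c i)) -> (forall n, \sum_(i < n) c i <= C) ->
  cost_le (\bigcup_i S i) C.
Proof.
move=> Sc cC s us sS.
have ex q : exists i, q \in s -> S i q.
  have [/sS[i _ Si]|] := boolP (q \in s); first by exists i.
  by move=> _; exists 0%N.
have [f fP] := choice ex.
pose m := (\max_(q <- s) f q).+1.
have fm q : q \in s -> (f q < m)%N by move=> qs; rewrite ltnS; apply: leq_bigmax_seq.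
apply: le_trans (cC m).
have -> : \sum_(q <- s) rho ^+ q.1 = \sum_(i < m) \sum_(q <- s | f q == i) rho ^+ q.1.
  rewrite (exchange_big_dep xpredT)//=; apply: eq_big_seq => q qs.
  by rewrite (big_pred1 (Ordinal (fm q qs)))// => i; rewrite -val_eqE.
apply: ler_sum => i _; rewrite -big_filter; apply: Sc; first exact: filter_uniq.
by move=> q; rewrite mem_filter => /andP[/eqP <-]; exact: fP.
Qed.

Lemma sum_dyadic_le (e : R) n : 0 <= e -> \sum_(i < n) e / 2 ^+ i.+1 <= e.
Proof.
move=> e0; suff -> : \sum_(i < n) e / 2 ^+ i.+1 = e - e / 2 ^+ n.
  by rewrite gerBl divr_ge0// exprn_ge0.
elim: n => [|n IH]; first by rewrite big_ord0 expr0 divr1 subrr.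
rewrite big_ord_recr/= IH exprS; have : (2 : R) ^+ n != 0 by rewrite expf_neq0.
by move=> ?; field.
Qed.

Lemma content_bigcup (A : nat -> set X) C :
  (forall n, \sum_(i < n) cell_content (A i) <= C) -> cell_content (\bigcup_i A i) <= C.
Proof.
move=> AC; apply/ler_addgt0Pr => e e0.
have ex i : exists S, covers S (A i) /\ cost_le S (cell_content (A i) + e / 2 ^+ i.+1).
  have e2 : 0 < e / 2 ^+ i.+1 by rewrite divr_gt0// exprn_gt0.
  by have [S ? ?] := content_adherent (A i) e2; exists S.
have [S SP] := choice ex.
apply: (content_le (S := \bigcup_i S i)).
  by move=> x [i _ Ax]; have [n Sn] := (SP i).1 x Ax; exists n, i.
apply: cost_bigcup (fun i => (SP i).2) _ => n.
by rewrite big_split/=; apply: lerD; [exact: AC|apply: sum_dyadic_le; exact: ltW].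
Qed.

Lemma content_bigcup_seq (I : eqType) (r : seq I) (A : I -> set X) B :
  (forall x, B x -> exists2 i, i \in r & A i x) ->
  cell_content B <= \sum_(i <- r) cell_content (A i).
Proof.
case: r => [|i0 r]; set l := (X in \sum_(i <- X) _) => BA.
  by rewrite big_nil -content0; apply: content_mono => x /BA[].
pose A' k := if (k < size l)%N then A (nth i0 l k) else set0.
apply: (@le_trans _ _ (cell_content (\bigcup_k A' k))).
  apply: content_mono => x /BA[i il Ax]; exists (index i l) => //.
  by rewrite /A' index_mem il nth_index.
apply: content_bigcup => n; rewrite (big_nth i0) big_mkord.
have cE k : cell_content (A' k) = if (k < size l)%N then cell_content (A (nth i0 l k)) else 0.
  by rewrite /A'; case: ifP => // _; exact: content0.
have [nl|ln] := leqP n (size l).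
  rewrite (big_ord_widen_cond _ xpredT (fun k => cell_content (A' k)) nl) big_mkcond/=.
  apply: ler_sum => k _; case: ifP => _; last exact: content_ge0.
  by rewrite cE ltn_ord.
rewrite (big_ord_widen_cond _ xpredT (fun k => cell_content (A (nth i0 l k))) (ltnW ln)).
rewrite [leRHS]big_mkcond/=; apply: ler_sum => k _; by rewrite cE.
Qed.

(** Almost optimal finite subfamilies of the disjoint families [S t] can be put
    together. *)
Lemma disjoint_costs (ts : seq T) (B : T -> set X) (S : T -> set (nat * T)) S0 c :
  uniq ts -> (forall t, t \in ts -> covers (S t) (B t)) ->
  (forall t q, t \in ts -> S t q -> S0 q) ->
  (forall t t' q, S t q -> S t' q -> t = t') -> cost_le S0 c ->
  \sum_(t <- ts) cell_content (B t) <= c.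
Proof.
move=> uts SB SS0 dS S0c; apply/ler_addgt0Pr => e e0.
have approx e' t : 0 < e' -> covers (S t) (B t) -> exists s,
    [/\ uniq s, forall q, q \in s -> S t q & cell_content (B t) <= \sum_(q <- s) rho ^+ q.1 + e'].
  move=> e'0 St; apply: contrapT => /forallNP H.
  suff : cell_content (B t) <= cell_content (B t) - e' by rewrite lerBrDr gerDl leNgt e'0.
  apply: content_le St _ => s us sS; rewrite leNgt; apply/negP => lt.
  by apply: (H s); split=> //; rewrite -lerBlDr ltW.
have key e' : 0 < e' -> forall ts, uniq ts -> (forall t, t \in ts -> covers (S t) (B t)) ->
    exists s, [/\ uniq s, forall q, q \in s -> exists2 t, t \in ts & S t q &
    \sum_(t <- ts) cell_content (B t) <= \sum_(q <- s) rho ^+ q.1 + (size ts)%:R * e'].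
  move=> e'0; elim=> [_ _|t ts' IH /= /andP[tts uts'] SB'].
    by exists [::]; split=> //; rewrite !big_nil mul0r addr0.
  have [|s [us sS sB]] := IH uts'.
    by move=> t' t'ts; apply: SB'; rewrite inE t'ts orbT.
  have [|s1 [us1 s1S s1B]] := approx e' t e'0; first by apply: SB'; rewrite mem_head.
  exists (s1 ++ s); split.
  - rewrite cat_uniq us1 us andbT/=; apply/hasPn => q /sS[t' t'ts St'].
    by apply/negP => /s1S St; move: tts; rewrite (dS _ _ _ St St') t'ts.
  - move=> q; rewrite mem_cat => /orP[/s1S|/sS[t' t'ts]] ?.
      by exists t; rewrite ?mem_head.
    by exists t' => //; rewrite inE t'ts orbT.
  - rewrite big_cons big_cat/= -natr1 mulrDl mul1r.
    by apply: le_trans (lerD s1B sB) _; rewrite addrACA [e' + _]addrC.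
have e'0 : 0 < e / (size ts).+1%:R by rewrite divr_gt0.
have [s [us sS sB]] := key _ e'0 ts uts SB.
apply: le_trans sB _; apply: lerD.
  by apply: S0c => // q /sS[t tts]; exact: SS0.
rewrite mulrCA ler_piMr ?(ltW e0)// ler_pdivrMr// mul1r ler_nat//.
Qed.

(** A covering of [A] of cost less than [rho ^+ n] uses only cells of level
    greater than [n], and each of these meets a single child of the cell. *)
Lemma content_split A n t (ts : seq T) : A `<=` Q (n, t) -> cell_content A < rho ^+ n ->
  uniq ts -> \sum_(t' <- ts) cell_content (A `&` Q (n.+1, t')) <= cell_content A.
Proof.
move=> AQ An uts; apply/ler_addgt0Pr => e e0.
have d0 : 0 < Num.min e ((rho ^+ n - cell_content A) / 2).
  by rewrite lt_min e0 divr_gt0// subr_gt0.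
have [S SA Sc] := content_adherent A d0.
have Sn q : S q -> (n < q.1)%N.
  move=> Sq; rewrite ltnNge; apply/negP => qn.
  have := Sc [:: q] isT; rewrite big_seq1 => /(_ _)/le_lt_trans.
  have qS : forall r, r \in [:: q] -> S r by move=> r; rewrite inE => /eqP->.
  have h : rho ^+ n <= rho ^+ q.1 by rewrite ler_wiXn2l// ltW.
  move=> /(_ (rho ^+ n) qS) H; suff : rho ^+ q.1 < rho ^+ n by rewrite ltNge h.
  apply: H; rewrite -ltrBrDl gt_min; apply/orP; right.
  by rewrite ltr_pdivrMr// ltr_pMr ?subr_gt0// ltr1n.
apply: (@le_trans _ _ (cell_content A + Num.min e ((rho ^+ n - cell_content A) / 2))); last first.
  by rewrite lerD2l ge_min lexx.
apply: (disjoint_costs (S := fun t' => [set q | S q /\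
   exists x, cell q.1 x = q.2 /\ cell n.+1 x = t']) uts _ _ _ Sc).
- move=> t' _ x [Ax /= xt]; have [k Sk] := SA x Ax.
  by exists k; split=> //; exists x.
- by move=> t' q _ [].
- move=> t' t'' q [/Sn nq [x [xq xt]]] [_ [y [yq yt]]].
  by rewrite -xt -yt; apply: (refine_le nq); rewrite xq yq.
Qed.

(** The content is only subadditive in general; it is superadditive over disjoint
    cells as long as the cells above them, where using a single large cell would be
    cheaper, are not saturated.  Induction on the depth [j] of the family below
    the cell [(n, t)], splitting that cell into its children. *)
Lemma content_antichain A : forall j n t s, uniq s ->
  (forall q, q \in s -> (n <= q.1 <= n + j)%N /\ exists x, [/\ cell q.1 x = q.2,
     cell n x = t & forall k, (n <= k < q.1)%N ->
       cell_content (A `&` Q (k, cell k x)) < rho ^+ k /\ (k, cell k x) \notin s]) ->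
  \sum_(q <- s) cell_content (A `&` Q q) <= cell_content (A `&` Q (n, t)).
Proof.
elim=> [|j IH] n t s us H.
all: have [->|[p ps]] : s = [::] \/ exists p, p \in s by
  case: (s) => [|p s']; [left|right; exists p; rewrite mem_head].
1,3: by rewrite big_nil content_ge0.
all: have [nts|nts] := boolP ((n, t) \in s).
1,3: have E q : q \in s -> q = (n, t) by
  (move=> qs; have [/andP[nq _] [x [xq xt xk]]] := H q qs;
   have [qn|nq'] := eqVneq q.1 n;
   [by rewrite [q]surjective_pairing -xq qn xt
   |by have := (xk n); rewrite leqnn ltn_neqAle eq_sym nq' nq xt nts => /(_ isT)[]]).
1,2: rewrite (big_rem _ nts)/= big1_seq ?addr0// => q /=;
  by rewrite mem_rem_uniq// inE => /andP[/eqP qn /E].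
  have [/andP[p1 p2] [x [xp xt _]]] := H p ps.
  have pn : p.1 = n by apply/eqP; rewrite eqn_leq p1 andbT -[n]addn0.
  by move: nts; rewrite -xt -pn xp -surjective_pairing ps.
have big q : q \in s -> (n < q.1)%N.
  move=> qs; have [/andP[nq _] [x [xq xt xk]]] := H q qs.
  rewrite ltn_neqAle nq andbT; apply: contraNN nts => /eqP nq'.
  by rewrite -xt nq' xq -surjective_pairing.
have low : cell_content (A `&` Q (n, t)) < rho ^+ n.
  have [/andP[nq _] [x [xq xt xk]]] := H p ps.
  by rewrite -xt; apply: (xk n _).1; rewrite leqnn big.
have exch q : exists x, q \in s -> [/\ cell q.1 x = q.2,
     cell n x = t & forall k, (n <= k < q.1)%N ->
       cell_content (A `&` Q (k, cell k x)) < rho ^+ k /\ (k, cell k x) \notin s].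
  have [qs|] := boolP (q \in s); first by have [_ [x ?]] := H q qs; exists x.
  have [_ [x _]] := H p ps; by exists x.
have [f fP] := choice exch.
pose ch q := cell n.+1 (f q).
pose ts := undup [seq ch q | q <- s].
have uts : uniq ts by exact: undup_uniq.
apply: le_trans (content_split (t := t) _ low uts); last by move=> x [].
have -> : \sum_(q <- s) cell_content (A `&` Q q) =
    \sum_(t' <- ts) \sum_(q <- [seq q <- s | ch q == t']) cell_content (A `&` Q q).
  under [RHS]eq_bigr do rewrite big_filter.
  rewrite (exchange_big_dep xpredT)//=; apply: eq_big_seq => q qs.
  have qts : ch q \in ts by rewrite mem_undup map_f.
  rewrite (big_rem _ qts)/= eqxx big1_seq ?addr0// => t' /andP[/eqP qt'].
  by rewrite mem_rem_uniq// inE qt' eqxx.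
rewrite big_seq [leRHS]big_seq; apply: ler_sum => t'; rewrite mem_undup => /mapP[q0 q0s t'E].
apply: (@le_trans _ _ (cell_content (A `&` Q (n.+1, t')))).
  apply: IH; first exact: filter_uniq.
  move=> q; rewrite mem_filter => /andP[/eqP qt' qs].
  have [/andP[_ q2] _] := H q qs; have [fq1 fq2 fq3] := fP q qs.
  split; first by rewrite big// addSnnS.
  exists (f q); split=> // k /andP[nk kq].
  have [|h1 h2] := fq3 k; first by rewrite kq andbT ltnW.
  by split=> //; rewrite mem_filter negb_and h2 orbT.
apply: content_mono => x [Ax /= xt']; split=> //; split=> //=.
have [_ <- _] := fP q0 q0s; apply: (@refine_le n n.+1) => //.
by rewrite xt' t'E.
Qed.

(** Call a cell saturated when, up to the factor [1 - e], some [A m] has in it the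
    largest possible content.  The maximal saturated cells form an antichain whose
    members lie only below unsaturated cells, so by [content_antichain] their total
    weight is at most [M / (1 - e)].  Let [B] be the set of the points in no saturated
    cell.  Replacing each cell of a covering of a part of [B] by its intersection with
    that part saves the factor [1 - e], so the content of that part is 0. *)
Lemma content_increasing (A : nat -> set X) M : (forall m, A m `<=` A m.+1) ->
  (forall m, cell_content (A m) <= M) -> cell_content (\bigcup_m A m) <= M.
Proof.
move=> Ainc AM.
have Ale m k : (m <= k)%N -> A m `<=` A k.
  move=> /subnK <-; elim: (k - m)%N => // i IH; rewrite addSn.
  exact: subset_trans (Ainc _).
have M0 : 0 <= M by apply: le_trans (AM 0%N); exact: content_ge0.
suff step e : 0 < e < 1 -> cell_content (\bigcup_m A m) * (1 - e) <= M.
  rewrite leNgt; apply/negP => MN.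
  set N := cell_content _ in step MN; have N0 : 0 < N by exact: le_lt_trans MN.
  have h : 0 < (N - M) / (2 * N) < 1.
    apply/andP; split; first by rewrite divr_gt0 ?subr_gt0 ?mulr_gt0.
    by rewrite ltr_pdivrMr ?mulr_gt0//; lra.
  have := step _ h.
  have -> : N * (1 - (N - M) / (2 * N)) = (N + M) / 2 by field; rewrite gt_eqF.
  lra.
move=> /andP[e0 e1].
pose sat q := exists m, (1 - e) * rho ^+ q.1 <= cell_content (A m `&` Q q).
pose S : set (nat * T) := [set q | sat q /\
  exists x, cell q.1 x = q.2 /\ forall k, (k < q.1)%N -> ~ sat (k, cell k x)].
pose B : set X := [set x | forall n, ~ sat (n, cell n x)].
have Sc : cost_le S (M / (1 - e)).
  move=> s us sS; rewrite ler_pdivlMr ?subr_gt0// mulrC mulr_sumr.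
  have ex q : exists m, q \in s -> (1 - e) * rho ^+ q.1 <= cell_content (A m `&` Q q).
    have [/sS[[m ?] _]|] := boolP (q \in s); first by exists m.
    by exists 0%N.
  have [f fP] := choice ex.
  pose m := \max_(q <- s) f q; pose K := \max_(q <- s) q.1.
  apply: le_trans (AM m).
  apply: (@le_trans _ _ (\sum_(q <- s) cell_content (A m `&` Q q))).
    rewrite big_seq [leRHS]big_seq; apply: ler_sum => q qs; apply: le_trans (fP q qs) _.
    apply: content_mono => x [Ax Qx]; split=> //; apply: Ale Ax.
    exact: leq_bigmax_seq.
  apply: (@le_trans _ _ (cell_content (A m `&` Q (0%N, t0)))); last first.
    by apply: content_mono => x [].
  apply: (content_antichain (j := K)) => // q qs; split.
    by rewrite add0n leq0n/=; apply: (leq_bigmax_seq (F := fun q => q.1)).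
  have [_ [x [xq xk]]] := sS q qs.
  exists x; split=> // k /andP[_ kq]; split.
    rewrite ltNge; apply/negP => h; apply: (xk k kq); exists m.
    by apply: le_trans h; rewrite ler_piMl ?rhoX_ge0// gerBl ltW.
  by apply/negP => /sS[kk _]; exact: (xk k kq).
have B0 m : cell_content (B `&` A m) = 0.
  have H e' : 0 < e' -> cell_content (B `&` A m) <= (1 - e) * (cell_content (B `&` A m) + e').
    move=> e'0; have [S' S'B S'c] := content_adherent (B `&` A m) e'0.
    pose P (i : nat) : set X := if pickle_inv i is Some q then
       [set x | [/\ S' q, B x, A m x & Q q x]] else set0.
    apply: (@le_trans _ _ (cell_content (\bigcup_i P i))).
      apply: content_mono => x [Bx Ax]; have [n S'n] := S'B x (conj Bx Ax).
      by exists (pickle (n, cell n x)) => //; rewrite /P pickleK_inv.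
    apply: content_bigcup => n.
    pose s := [seq q <- pmap pickle_inv (iota 0 n) | `[< S' q >]].
    have us : uniq s.
      by apply/filter_uniq/(pmap_uniq (@pickle_invK _))/iota_uniq.
    apply: (@le_trans _ _ ((1 - e) * \sum_(q <- s) rho ^+ q.1)); last first.
      rewrite ler_wpM2l ?subr_ge0 ?(ltW e1)//; apply: S'c => // q.
      by rewrite mem_filter => /andP[/asboolP].
    rewrite mulr_sumr /s big_filter [leRHS]big_mkcond/=.
rewrite big_pmap -(big_mkord xpredT (fun i => cell_content (P i))).
    rewrite /index_iota subn0; apply: ler_sum => i _.
    rewrite /P; case: (pickle_inv i) => [q|]/=; last by rewrite content0.
    case: asboolP => [S'q|nS']; last first.
      by rewrite -content0; apply: content_mono => x [] /nS'.
    have [|/forallNP em] := pselect (exists x, B x /\ Q q x).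
      move=> [x [Bx Qx]]; apply: (@le_trans _ _ (cell_content (A m `&` Q q))).
        by apply: content_mono => y [].
      apply: ltW; rewrite ltNge; apply/negP => h.
      by apply: (Bx q.1); exists m; move: h; rewrite /= Qx -surjective_pairing.
    apply: (@le_trans _ _ 0); last by rewrite mulr_ge0 ?rhoX_ge0// subr_ge0 ltW.
    rewrite -content0; apply: content_mono => x [_ Bx _ Qx].
    exact: (em x).
  apply/eqP; rewrite eq_le content_ge0 andbT; set N := cell_content _.
  rewrite leNgt; apply/negP => N0.
  have := H (e * N / 2); rewrite !mulr_gt0 ?invr_gt0// => /(_ isT).
  have : 0 < e * N by rewrite mulr_gt0.
  have : 0 < e * (e * N) by rewrite !mulr_gt0.
  by move: e1; nra.
have BU : cell_content (B `&` \bigcup_m A m) <= 0.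
  rewrite setI_bigcupr; apply: content_bigcup => n.
  by rewrite big1// => i _; exact: B0.
have := content_bigcup_seq (r := [:: true; false])
  (A := fun b => if b then B `&` \bigcup_m A m else \bigcup_m A m `\` B)
  (B := \bigcup_m A m).
move=> /(_ _)/le_trans H; rewrite -ler_pdivlMr ?subr_gt0//; apply: H.
  move=> x Ux; have [xB|xB] := pselect (B x).
    by exists true.
  by exists false; rewrite ?inE.
rewrite big_cons big_seq1 -[leRHS]add0r; apply: lerD => //.
apply: (content_le (S := S)) => // x [_ nB].
have [n sn] : exists n, `[< sat (n, cell n x) >].
  by apply: contrapT => /forallNP h; apply: nB => n /asboolP; exact: h.
have exn : exists n, `[< sat (n, cell n x) >] by exists n.
exists (ex_minn exn); case: ex_minnP => k /asboolP satk kmin.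
split=> //; exists x; split=> //= i ik /asboolP/kmin.
by rewrite leqNgt ik.
Qed.
End Content.

(** * Frostman masses *)

Section Frostman.
Variable R : realType.
Variables (X : choiceType) (T : countType) (cell : nat -> X -> T).
Variables (rho : R) (t0 : T) (L : nat -> seq T).
Hypothesis rho0 : 0 < rho.
Hypothesis cell0 : forall x, cell 0 x = t0.
Hypothesis refine : forall n x y, cell n.+1 x = cell n.+1 y -> cell n x = cell n y.
Hypothesis cellL : forall n x, cell n x \in L n.
Local Notation content := (cell_content cell rho).

(** Masses for the children of a cell are put together; if their total exceeds
    the content of the cell, which happens when one covers the cell by itself, they
    are scaled down. *)
Lemma frostman_subtree m : forall n t (A : set X), (forall x, A x -> cell n x = t) ->
  exists s : seq (R * X), [/\ forall p, p \in s -> 0 <= p.1 /\ A p.2,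
    \sum_(p <- s) p.1 = content A &
    forall l t', (n <= l <= n + m)%N -> \sum_(p <- s | cell l p.2 == t') p.1 <= rho ^+ l].
Proof.
elim: m => [|m IH] n t A At.
  have [[x Ax]|/forallNP A0] := pselect (exists x, A x); last first.
    exists [::]; split=> //; last by move=> *; rewrite big_nil rhoX_ge0.
    have -> : A = set0 by rewrite -subset0 => x Ax; exact: (A0 x).
    by rewrite big_nil (content0 rho0 cell0).
  exists [:: (content A, x)]; split.
  - by move=> p; rewrite inE => /eqP->/=; split=> //; exact: (content_ge0 rho0 cell0).
  - by rewrite big_seq1.
  - move=> l t'; rewrite addn0 -eqn_leq => /eqP <-; rewrite big_cons big_nil/=.
    case: ifP => _; last by rewrite rhoX_ge0.
    by rewrite addr0; apply: (content_cell rho0 (q := (n, t))).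
pose ch := undup (L n.+1).
have ex t' : exists s : seq (R * X),
    [/\ forall p, p \in s -> 0 <= p.1 /\ (A p.2 /\ cell n.+1 p.2 = t'),
    \sum_(p <- s) p.1 = content (A `&` [set x | cell n.+1 x = t']) &
    forall l t'', (n.+1 <= l <= n.+1 + m)%N ->
      \sum_(p <- s | cell l p.2 == t'') p.1 <= rho ^+ l].
  by apply: (IH n.+1 t' (A `&` [set x | cell n.+1 x = t'])) => x [].
have [f fP] := choice ex.
pose s0 := flatten [seq f t' | t' <- ch].
pose tot := \sum_(p <- s0) p.1.
have s0P p : p \in s0 -> 0 <= p.1 /\ A p.2.
  move=> /flatten_mapP[t' _ pf].
  by have [/(_ p pf)[? [? _]]] := fP t'.
have At' : content A <= tot.
  rewrite /tot /s0 big_flatten big_map/=.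
  rewrite (eq_bigr (fun t' => content (A `&` [set x | cell n.+1 x = t']))); last first.
    by move=> t' _; have [_ ->] := fP t'.
  apply: (content_bigcup_seq rho0 cell0) => x Ax.
  by exists (cell n.+1 x) => //; rewrite mem_undup.
have cA0 : 0 <= content A by exact: (content_ge0 rho0 cell0).
have tot0 : 0 <= tot by exact: le_trans At'.
pose c := content A / tot.
have c0 : 0 <= c by rewrite divr_ge0.
have c1 : c <= 1.
  rewrite /c; have [->|tn] := eqVneq tot 0; first by rewrite invr0 mulr0.
  by rewrite ler_pdivrMr ?mul1r// lt_neqAle eq_sym tn.
have ctot : c * tot = content A.
  rewrite /c; have [t00|tn] := eqVneq tot 0; last by rewrite divfK.
  by rewrite t00 mulr0; apply/eqP; rewrite eq_le cA0 -t00.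
exists [seq (c * p.1, p.2) | p <- s0]; split.
- move=> p /mapP[q /s0P[q1 q2] ->]/=; split=> //; exact: mulr_ge0.
- by rewrite big_map/= -mulr_sumr.
- move=> l t' /andP[nl ln]; rewrite big_map/= -mulr_sumr.
  have [->|nl'] := eqVneq l n.
    apply: (@le_trans _ _ (content A)).
      rewrite -ctot ler_wpM2l// /tot big_mkcond/= !big_seq; apply: ler_sum => p /s0P[p0 _].
      by case: ifP.
    exact: (content_cell rho0 (q := (n, t))).
  have nl1 : (n.+1 <= l)%N by rewrite ltn_neqAle eq_sym nl' nl.
  apply: (@le_trans _ _ (\sum_(p <- s0 | cell l p.2 == t') p.1)).
    rewrite ler_piMl// big_seq_cond; apply: sumr_ge0 => p /andP[/s0P[]]//.
  rewrite /s0 big_flatten big_map/=.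
  have [[x xt]|/forallNP none] := pselect (exists x, cell l x = t'); last first.
    rewrite big1 ?rhoX_ge0// => t'' _; rewrite big1// => p /eqP e.
    by have := none p.2.
  have xch : cell n.+1 x \in ch by rewrite mem_undup.
  rewrite (big_rem _ xch)/= [X in _ + X]big1_seq ?addr0.
    have [_ _] := fP (cell n.+1 x); apply; rewrite nl1/=.
    by rewrite addSnnS.
  move=> t'' /=; rewrite mem_rem_uniq ?undup_uniq// inE => /andP[t''x _].
  rewrite big_seq_cond big1// => p /andP[pf /eqP pt].
  have [/(_ p pf)[_ [_ pt'']] _ _] := fP t''.
  case/negP: t''x; rewrite -pt''; apply/eqP.
  by apply: (refine_le refine nl1); rewrite pt xt.
Qed.

Lemma frostman m (A : set X) :
  exists k (w : 'I_k -> R) (x : 'I_k -> X),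
   [/\ forall i, 0 <= w i, forall i, A (x i), \sum_i w i = content A &
    forall l t, (l <= m)%N -> \sum_(i | cell l (x i) == t) w i <= rho ^+ l].
Proof.
have [s [sP sT sF]] := @frostman_subtree m 0 t0 A (fun x _ => cell0 x).
case: s sP sT sF => [|p0 s'] sP sT sF.
  have x : 'I_0 -> X by case.
  exists 0%N, (fun=> 0), x; split; do ?by case.
    by rewrite -sT big_nil big_ord0.
  by move=> l t _; rewrite big1 ?rhoX_ge0.
set s := p0 :: s' in sP sT sF.
exists (size s), (fun i => (nth p0 s i).1), (fun i => (nth p0 s i).2); split.
- by move=> i; have [] := sP _ (mem_nth p0 (ltn_ord i)).
- by move=> i; have [] := sP _ (mem_nth p0 (ltn_ord i)).
- by rewrite -sT (big_nth p0) big_mkord.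
- by move=> l t lm; have := sF l t lm; rewrite (big_nth p0) big_mkord.
Qed.
End Frostman.

(** * Borel sets are Suslin sets *)

Section Suslin.

(** The graph of a closed subset of T x N^N, the second factor carrying the
    topology of agreement on initial segments. *)
Definition closed_code (T : topologicalType) (C : T -> (nat -> nat) -> Prop) : Prop :=
  forall x sigma,
    (forall n (U : set T), nbhs x U -> exists y tau,
        [/\ U y, forall i, (i < n)%N -> tau i = sigma i & C y tau]) ->
    C x sigma.

Definition suslin (T : topologicalType) (A : set T) : Prop :=
  exists2 C : T -> (nat -> nat) -> Prop,
    closed_code C & A = [set x | exists sigma, C x sigma].

Lemma suslin_bigcup (T : topologicalType) (A : nat -> set T) :
  (forall i, suslin (A i)) -> suslin (\bigcup_i A i).
Proof.
move=> sA.
have /choice[C CP] : forall i, exists C : T -> (nat -> nat) -> Prop,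
    closed_code C /\ A i = [set x | exists sigma, C x sigma].
  by move=> i; have [C ? ?] := sA i; exists C.
exists (fun x sigma => C (sigma 0%N) x (fun i => sigma i.+1)) => [x sigma H|].
  apply: (CP (sigma 0%N)).1 => n U xU.
  have [y [tau [Uy ts Cy]]] := H n.+1 U xU.
  exists y, (fun i => tau i.+1); split=> //; last by rewrite ts in Cy.
  by move=> i ni; rewrite ts.
apply/seteqP; split=> [x [i _]|x [sigma Cx]].
  rewrite (CP i).2 => -[sigma Cx].
  by exists (fun k => if k is k'.+1 then sigma k' else i).
by exists (sigma 0%N) => //; rewrite (CP _).2; exists (fun i => sigma i.+1).
Qed.

(** A sequence of integers encodes a sequence of such sequences by means of the
    pairing [pickle]; closedness survives because an initial segment of the [i]-th
    sequence only depends on an initial segment of the code. *)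
Lemma suslin_bigcap (T : topologicalType) (A : nat -> set T) :
  (forall i, suslin (A i)) -> suslin (\bigcap_i A i).
Proof.
move=> sA.
have /choice[C CP] : forall i, exists C : T -> (nat -> nat) -> Prop,
    closed_code C /\ A i = [set x | exists sigma, C x sigma].
  by move=> i; have [C ? ?] := sA i; exists C.
exists (fun x sigma => forall i, C i x (fun j => sigma (pickle (i, j)))) => [x sigma H i|].
  apply: (CP i).1 => n U xU.
  pose m := (\max_(j < n) pickle (i, val j)).+1.
  have [y [tau [Uy ts Cy]]] := H m U xU.
  exists y, (fun j => tau (pickle (i, j))); split=> // j jn.
  rewrite ts// ltnS.
  exact: (leq_bigmax (F := fun j : 'I_n => pickle (i, val j)) (Ordinal jn)).
apply/seteqP; split=> [x Ax|x [sigma Cx] i _].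
  have /choice[s sP] : forall i, exists sigma, C i x sigma.
    by move=> i; have := Ax i I; rewrite (CP i).2.
  exists (fun k => if unpickle k is Some (i, j) then s i j else 0%N) => i.
  by under eq_fun do rewrite pickleK.
by rewrite (CP i).2; exists (fun j => sigma (pickle (i, j))).
Qed.

Lemma suslin_setC (T : topologicalType) (A : set T) : open A -> suslin (~` A).
Proof.
move=> oA; exists (fun x _ => ~ A x) => [x sigma H Ax|].
  have [y [tau [Ay _ nAy]]] := H 0%N A (open_nbhs_nbhs (conj oA Ax)).
  exact: nAy.
by apply/seteqP; split=> [x nA|x [_]//]; exists (fun=> 0%N).
Qed.

(** The code of a point of [A] is a bound from below on its distance to the
    complement. *)
Lemma suslin_open (R : realType) (V : normedModType R) (A : set V) :
  open A -> suslin A.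
Proof.
move=> oA.
exists (fun x sigma => forall z, ~ A z -> (sigma 0%N).+1%:R^-1 <= `|x - z|).
  move=> x sigma H z Az; apply/ler_addgt0Pr => e e0.
  have [y [tau [xy ts Cy]]] := H 1%N (ball x e) (nbhsx_ballx x e e0).
  have := Cy z Az; rewrite ts// => /le_trans; apply.
  rewrite -[y - z](subrKA x); apply: le_trans (ler_normD _ _) _.
  by rewrite addrC lerD2l distrC ltW//; move: xy; rewrite -ball_normE.
apply/seteqP; split=> [x Ax|x [sigma H]].
  have /nbhs_ballP[e /= e0 eA] := open_nbhs_nbhs (conj oA Ax).
  exists (fun=> Num.truncn e^-1) => z Az.
  rewrite leNgt; apply/negP => xz; apply/Az/eA; rewrite -ball_normE/=.
  apply: lt_trans xz _; rewrite invf_plt ?posrE//; exact: truncnS_gt.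
apply: contrapT => Ax; have := H x Ax.
by rewrite subrr normr0 leNgt invr_gt0 ltr0n.
Qed.

(** The sets that are Suslin together with their complements form a sigma-algebra. *)
Lemma borel_suslin (R : realType) (n m : nat) (A : set 'M[R]_(n.+1, m.+1)) :
  borel_set A -> suslin A.
Proof.
move=> /(_ [set B | suslin B /\ suslin (~` B)]) H.
suff [] : suslin A /\ suslin (~` A) by [].
apply: H; split; last first.
  by move=> U oU; split; [exact: suslin_open|exact: suslin_setC].
split.
- split; last by apply: suslin_setC; exact: open0.
  by rewrite -[set0]setCK; apply: suslin_setC; rewrite setC0; exact: openT.
- by move=> B [sB sB']; rewrite setTD; split=> //; rewrite setCK.
- move=> B sB; split; first by apply: suslin_bigcup => i; have [] := sB i.
  by rewrite setC_bigcup; apply: suslin_bigcap => i; have [] := sB i.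
Qed.

End Suslin.

(** * Cells in the unit cube and Hausdorff measure *)

Section Cells.
Variable R : realType.
Notation V := 'cV[R]_3.

(** Half of the coordinate, so that the point 1 falls into the same cell of level 0
    as 0; clamped, so that each level has finitely many cells. *)
Definition half_clamp (t : R) : R := Num.max 0 (Num.min t 1) / 2.

Lemma half_clamp_itv t : 0 <= half_clamp t <= 1 / 2.
Proof.
rewrite /half_clamp ler_pM2r// divr_ge0 ?le_max ?lexx//=.
by rewrite ge_max ler01 ge_min lexx orbT.
Qed.

Lemma half_clampE t : 0 <= t <= 1 -> half_clamp t = t / 2.
Proof. by move=> /andP[t0 t1]; rewrite /half_clamp min_l// max_r. Qed.

Definition digit n (t : R) : nat := Num.truncn (32 ^+ n * half_clamp t).

Lemma digit_itv n t : (digit n t)%:R <= 32 ^+ n * half_clamp t < (digit n t).+1%:R.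
Proof. by apply: truncn_itv; have /andP[h _] := half_clamp_itv t; pos. Qed.

Lemma digit0 t : digit 0 t = 0%N.
Proof.
have /andP[h1 h2] := half_clamp_itv t; rewrite /digit expr0 mul1r.
apply/eqP; rewrite truncn_eq// h1/=; lra.
Qed.

Lemma digitS n t : digit n t = (digit n.+1 t %/ 32)%N.
Proof.
have /andP[h1 h2] := digit_itv n.+1 t.
apply/eqP; rewrite /digit truncn_eq; last first.
  by have /andP[h _] := half_clamp_itv t; pos.
rewrite exprS -mulrA in h1 h2.
set d := digit n.+1 t in h1 h2 *; set y := 32 ^+ n * half_clamp t in h1 h2 *.
have e1 : (32 * (d %/ 32))%:R <= d%:R :> R by rewrite ler_nat mulnC leq_divM.
have e2 : d.+1%:R <= (32 * (d %/ 32).+1)%:R :> R by rewrite ler_nat mulnC ltn_ceil.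
rewrite !natrM in e1 e2; apply/andP; split; lra.
Qed.

Lemma digit_lt n t : (digit n t < (32 ^ n).+1)%N.
Proof.
rewrite ltnS -(ler_nat R) natrX; have /andP[h1 _] := digit_itv n t.
apply: le_trans h1 _; rewrite ler_piMr ?exprn_ge0//.
by have /andP[_ h] := half_clamp_itv t; lra.
Qed.

Definition cube_cell n (x : V) : nat * nat * nat :=
  (digit n (x 0 0), digit n (x 1 0), digit n (x 2 0)).

Lemma cube_cell0 x : cube_cell 0 x = (0, 0, 0)%N.
Proof. by rewrite /cube_cell !digit0. Qed.

Lemma cube_cell_refine n x y : cube_cell n.+1 x = cube_cell n.+1 y ->
  cube_cell n x = cube_cell n y.
Proof. by rewrite /cube_cell => -[e0 e1 e2]; rewrite !(digitS n) e0 e1 e2. Qed.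

Definition cell_list n : seq (nat * nat * nat) :=
  let r := iota 0 (32 ^ n).+1 in
  [seq (p, k) | p <- [seq (i, j) | i <- r, j <- r], k <- r].

Lemma cube_cellL n x : cube_cell n x \in cell_list n.
Proof.
have h t : digit n t \in iota 0 (32 ^ n).+1 by rewrite mem_iota leq0n add0n digit_lt.
apply/allpairsP; exists ((digit n (x 0 0), digit n (x 1 0)), digit n (x 2 0)).
split; [|exact: h|by []].
by apply/allpairsP; exists (digit n (x 0 0), digit n (x 1 0)); split; [exact: h|exact: h|].
Qed.

(** [32^(-13/5)], the weight of a cell of level 1. *)
Definition cell_weight : R := (2 ^+ 13)^-1.
Lemma cell_weight_gt0 : 0 < cell_weight. Proof. by rewrite invr_gt0 exprn_gt0. Qed.
Lemma cell_weight_le1 : cell_weight <= 1.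
Proof. by rewrite invf_le1 ?exprn_gt0// exprn_ege1// ler1n. Qed.

Lemma digit_near n s t : 0 <= s <= 1 -> 0 <= t <= 1 -> digit n s = digit n t ->
  `|s - t| <= 2 * scale R n.
Proof.
move=> s1 t1 st; have /andP[h1 h2] := digit_itv n s; have /andP[h3 h4] := digit_itv n t.
rewrite st in h1 h2; rewrite !half_clampE// in h1 h2 h3 h4.
have p0 : 0 < (32 : R) ^+ n by rewrite exprn_gt0.
rewrite /scale ler_pdivlMr// -[X in _ * X](gtr0_norm p0) -normrM ler_norml mulrBl.
move: h1 h2 h3 h4; rewrite -(natr1 (digit n t)); move: (32 ^+ n) (digit n t) => p D *.
by apply/andP; split; lra.
Qed.

Lemma digit_close n s t : 0 <= s <= 1 -> 0 <= t <= 1 -> `|s - t| <= scale R n ->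
  (digit n s <= (digit n t).+1)%N.
Proof.
move=> s1 t1; have /andP[h1 h2] := digit_itv n s; have /andP[h3 h4] := digit_itv n t.
rewrite !half_clampE// in h1 h2 h3 h4.
have p0 : 0 < (32 : R) ^+ n by rewrite exprn_gt0.
rewrite /scale -[leRHS]mul1r ler_pdivlMr// => st.
have {}st : 32 ^+ n * (s - t) <= 1.
  by apply: le_trans st; rewrite mulrC ler_wpM2r ?ler_norm// ltW.
rewrite -ltnS -(ltr_nat R) -(natr1 (digit n t).+1).
by move: h1 h4 st; rewrite mulrBr; move: (32 ^+ n) (digit n t).+1 => *; lra.
Qed.

Lemma cell_diam n (x y : V) : unit_cube x -> unit_cube y ->
  cube_cell n x = cube_cell n y -> eucl_dist x y <= 4 * scale R n.
Proof.
move=> cx cy [e0 e1 e2]; rewrite /eucl_dist.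
have s0 := scale_ge0 R n.
rewrite -(ger0_norm (_ : 0 <= 4 * scale R n)); last by pos.
rewrite -sqrtr_sqr ler_wsqrtr// !big_ord_recl big_ord0.
have h i : digit n (x i 0) = digit n (y i 0) -> (x i 0 - y i 0) ^+ 2 <= 4 * scale R n ^+ 2.
  move=> e; have := digit_near (cx i) (cy i) e.
  rewrite -(real_normK (num_real (_ - _))) => H.
  have -> : 4 * scale R n ^+ 2 = (2 * scale R n) ^+ 2 by ring.
  by rewrite lerXn2r ?nnegrE//; pos.
have := h 0 e0; have := h 1 e1; have := h 2 e2.
have -> : lift ord0 (lift ord0 ord0) = 2 :> 'I_3 by apply: val_inj.
have -> : lift ord0 ord0 = 1 :> 'I_3 by apply: val_inj.
by rewrite exprMn; have := sqr_ge0 (scale R n); lra.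
Qed.

Notation cc := (cell_content cube_cell cell_weight).

Lemma scale_powR n : (scale R n) `^ (13 / 5) = cell_weight ^+ n.
Proof.
pose a : R := (2 ^+ n)^-1; have a0 : 0 <= a by rewrite /a; pos.
have -> : scale R n = a ^+ 5.
  rewrite /scale /a exprVn; congr (_^-1); rewrite exprAC; congr (_ ^+ n); ring.
have -> : cell_weight ^+ n = a ^+ 13 by rewrite /cell_weight /a !exprVn exprAC.
rewrite -(powR_mulrn 5 a0) -powRrM -(powR_mulrn 13 a0); congr (_ `^ _); lra.
Qed.

(** If the content were 0, the set would have coverings by cells of arbitrarily small
    cost; a small cost forces all the cells to be small, so the coverings are
    admissible for the Hausdorff measure of dimension 13/5, which would vanish. *)
Lemma hausdorff_content (E : set V) : E `<=` @unit_cube R 3 ->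
  ((13 / 5)%:E < hausdorff_dim E)%E -> 0 < cc E.
Proof.
move=> Ec Edim; rewrite lt_neqAle (content_ge0 cell_weight_gt0 cube_cell0) andbT eq_sym.
apply/negP => /eqP c0; move: Edim; rewrite ltNge => /negP; apply.
apply: ereal_inf_lbound; exists (13 / 5) => //; split; first by rewrite divr_ge0.
have ge0 (U : nat -> set V) k : (0 <= diam_pow (13 / 5) (U k))%E.
  by rewrite /diam_pow; case: ifP => // _; exact: poweR_ge0.
have pre0 d : (0 <= hausdorff_premeasure (13 / 5) d E)%E.
  apply: le_ereal_inf_tmp => _ [U _ <-]; exact: nneseries_ge0.
have pre d : 0 < d -> (hausdorff_premeasure (13 / 5) d E <= 0)%E.
  move=> d0; apply/lee_addgt0Pr => e e0; rewrite add0e.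
  (* A cost less than [cell_weight ^+ N] only leaves cells of level greater than
     [N], hence of diameter at most [d]. *)
  pose N := Num.truncn (4 / d).
  have Nd : 4 * scale R N <= d.
    rewrite /scale ler_pdivrMr ?exprn_gt0// -ler_pdivrMl// mulrC.
    apply: ltW; apply: lt_le_trans (truncnS_gt _) _.
    by rewrite -natrX ler_nat ltn_expl.
  have e'0 : 0 < Num.min (e / 64) (cell_weight ^+ N).
    by rewrite lt_min divr_gt0//= exprn_gt0// cell_weight_gt0.
  set e' := Num.min _ _ in e'0.
  have [S SE Sc] := content_adherent cell_weight_gt0 cube_cell0 E e'0.
  rewrite c0 add0r in Sc.
  have SN q : S q -> (N <= q.1)%N.
    move=> Sq; rewrite leqNgt; apply/negP => qN.
    have : cell_weight ^+ q.1 <= e'.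
      have := Sc [:: q] isT; rewrite big_seq1; apply => r.
      by rewrite inE => /eqP->.
    rewrite le_min => /andP[_]; rewrite leNgt => /negP; apply.
    by rewrite ltr_iXn2l// ?cell_weight_gt0//; rewrite invf_lt1 ?exprn_gt0// exprn_egt1// ltr1n.
  pose U k : set V := if @pickle_inv (nat * (nat * nat * nat))%type k is Some q
     then [set x | [/\ S q, E x & cube_cell q.1 x = q.2]] else set0.
  have dU k q : @pickle_inv (nat * (nat * nat * nat))%type k = Some q ->
     (diam (U k) <= (4 * scale R q.1)%:E)%E.
    move=> kq; apply: ge_ereal_sup => _ [x Ux [y Uy <-]].
    rewrite /U kq in Ux Uy; case: Ux Uy => [_ Ex qx] [_ Ey qy].
    by rewrite lee_fin; apply: cell_diam; rewrite ?qx ?qy//; exact: Ec.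
  apply: (@le_trans _ _ (\sum_(0 <= k <oo) diam_pow (13 / 5) (U k))%E).
    apply: ereal_inf_lbound; exists U => //; split.
      move=> k; case kq : (@pickle_inv (nat * (nat * nat * nat))%type k) => [q|]; last first.
        by apply: ge_ereal_sup => _ [x Ux [y _ <-]]; move: Ux; rewrite /U kq.
      have [Sq|nSq] := pselect (S q).
        apply: le_trans (dU k q kq) _; rewrite lee_fin; apply: le_trans Nd.
        rewrite ler_wpM2l// /scale lef_pV2 ?posrE ?exprn_gt0//.
        by rewrite ler_weXn2l ?ler1n// SN.
      by apply: ge_ereal_sup => _ [x Ux [y _ <-]]; move: Ux; rewrite /U kq => -[].
    move=> x Ex; have [n Sn] := SE x Ex.
    by exists (pickle (n, cube_cell n x)) => //; rewrite /U pickleK_inv.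
  apply: lime_le; first exact: is_cvg_nneseries.
  apply: nearW => n.
  have key k : (diam_pow (13 / 5) (U k) <=
     (oapp (fun q => if `[< S q >] then 64 * cell_weight ^+ q.1 else 0) 0
       (@pickle_inv (nat * (nat * nat * nat))%type k))%:E)%E.
    rewrite /diam_pow; case: eqP => [_|/eqP /set0P[x Ux]].
      case: pickle_inv => [q|]//=; rewrite lee_fin; case: ifP => // _.
      by rewrite mulr_ge0// exprn_ge0// ltW// cell_weight_gt0.
    have diam0 : (0 <= diam (U k))%E.
      apply: (@le_trans _ _ (eucl_dist x x)%:E); first by rewrite lee_fin sqrtr_ge0.
      by apply: ereal_sup_ubound; exists x => //; exists x.
    move: (dU k) diam0; move: Ux; rewrite {1}/U.
    case: pickle_inv => [q|]//= [Sq _ _] /(_ q erefl) dq diam0.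
    rewrite asboolT//; apply: (@le_trans _ _ (poweR (4 * scale R q.1)%:E (13 / 5))).
      have p0 : 0 <= 13 / 5 :> R by rewrite divr_ge0.
      apply: (gt0_ler_poweR p0) => //; first by rewrite in_itv/= leey andbT.
      by rewrite in_itv/= leey andbT lee_fin; apply: mulr_ge0 => //; exact: scale_ge0.
    rewrite poweR_EFin lee_fin powRM ?scale_ge0// scale_powR ler_wpM2r//.
      by rewrite exprn_ge0// ltW// cell_weight_gt0.
    (* [64 = 4 ^ 3] bounds [4 ^ (13 / 5)]. *)
    apply: (@le_trans _ _ (4 `^ 3%:R)).
      by rewrite ler_powR ?ler1n//; lra.
    rewrite powR_mulrn//; lra.
  apply: (@le_trans _ _ (\sum_(0 <= k < n)
     (oapp (fun q => if `[< S q >] then 64 * cell_weight ^+ q.1 else 0) 0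
       (@pickle_inv (nat * (nat * nat * nat))%type k))%:E)%E).
    by apply: lee_sum => k _; exact: key.
  rewrite sumEFin lee_fin /index_iota subn0 -big_pmap -big_mkcond -big_filter.
  rewrite -mulr_sumr; apply: (@le_trans _ _ (64 * e')).
    rewrite ler_wpM2l//; apply: Sc.
      exact/filter_uniq/(pmap_uniq (@pickle_invK _))/iota_uniq.
    by move=> q; rewrite mem_filter => /andP[/asboolP].
  by rewrite mulrC -ler_pdivlMr// ge_min lexx.
apply/eqP; rewrite eq_le; apply/andP; split.
  by apply: ge_ereal_sup => _ [d /= d0 <-]; exact: pre.
by apply: le_trans (pre0 1) _; apply: ereal_sup_ubound; exists 1 => //=.
Qed.

End Cells.

(** * Neighbourhoods of the volume set *)

Section Volume.
Variable R : realType.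
Notation V := 'cV[R]_3.
Notation cc := (cell_content (@cube_cell R) (cell_weight R)).

(** A ball of radius [32^(-n)] meets at most 27 cells of level [n]: the cells have side
    [2 * 32^(-n)], so the digits of two of its points differ by at most 1 from those
    of the centre. *)
Lemma cube_ball (I : finType) (w : I -> R) (x : I -> V) n i :
  (forall i, 0 <= w i) -> (forall i, unit_cube (x i)) ->
  (forall t, \sum_(i | cube_cell n (x i) == t) w i <= cell_weight R ^+ n) ->
  \sum_(i' | coords_close (fun i => x i 0 0) (fun i => x i 1 0) (fun i => x i 2 0)
     (scale R n) i i') w i' <= 27 / (2 ^+ 13) ^+ n.
Proof.
move=> w0 xc wF.
(* The digits relative to the centre, shifted by 1 to be nonnegative. *)
pose cd j i' : 'I_3 := inord ((digit n (x i' j 0)).+1 - digit n (x i j 0%R)).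
pose f i' := (cd 0 i', cd 1 i', cd 2 i').
have cdE j i' : `|x i' j 0 - x i j 0| <= scale R n ->
    digit n (x i' j 0) = (digit n (x i j 0%R) + cd j i' - 1)%N.
  move=> h; have h' : `|x i j 0 - x i' j 0| <= scale R n by rewrite distrC.
  have d1 := digit_close (xc i' j) (xc i j) h.
  have d2 := digit_close (xc i j) (xc i' j) h'.
  rewrite /cd inordK; last by rewrite ltn_subLR// addn3; exact: (leq_trans d1).
  by rewrite subnKC// subn1.
rewrite (partition_big f xpredT)//=.
apply: (@le_trans _ _ (\sum_(c : 'I_3 * 'I_3 * 'I_3) cell_weight R ^+ n)); last first.
  rewrite sumr_const !card_prod !card_ord /cell_weight exprVn -[leLHS]mulr_natl.
  by rewrite ler_wpM2r ?invr_ge0 ?exprn_ge0// ler_nat.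
apply: ler_sum => -[[c0 c1] c2] _.
apply: le_trans (wF (digit n (x i 0%R 0%R) + c0 - 1, digit n (x i 1%R 0%R) + c1 - 1,
   digit n (x i 2%R 0%R) + c2 - 1)%N).
rewrite big_mkcond [leRHS]big_mkcond/=; apply: ler_sum => i' _.
case: ifP => [/andP[/and3P[h0 h1 h2] /eqP[<- <- <-]]|_]; last by case: ifP.
by rewrite ifT// /cube_cell (cdE 0)// (cdE 1)// (cdE 2).
Qed.

Definition vol (x : 'I_3 -> V) : R := \det (\matrix_(i < 3, j < 3) x j i 0).

Lemma volE (x : 'I_3 -> V) : vol x =
  x 0 0 0 * (x 1 1 0 * x 2 2 0 - x 1 2 0 * x 2 1 0)
  - x 1 0 0 * (x 0 1 0 * x 2 2 0 - x 0 2 0 * x 2 1 0)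
  + x 2 0 0 * (x 0 1 0 * x 1 2 0 - x 0 2 0 * x 1 1 0).
Proof.
have [x' xE] : exists x' : nat -> nat -> R, forall a b, x a b 0 = x' (val a) (val b).
  by exists (fun a b => x (inord a) (inord b) 0) => a b; rewrite !inord_val.
rewrite /vol (expand_det_row _ 0) !big_ord_recl big_ord0 /cofactor.
rewrite !(expand_det_row _ 0) !big_ord_recl !big_ord0 /cofactor.
rewrite !det_mx11 !mxE /= !xE /= /bump /=; ring.
Qed.

Definition vol_nbhd (A : set V) (e : R) : set R :=
  [set y | exists2 x : 'I_3 -> V, (forall j, A (x j)) & `|y - vol x| < e].

(** The resolution is chosen smaller than [e], so that every cell occupied by a
    determinant lies in the neighbourhood. *)
Lemma volume_neighbourhood (c0 : R) : 0 < c0 -> exists2 c : R, 0 < c &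
  forall A : set V, A `<=` @unit_cube R 3 -> c0 <= cc A -> forall e, 0 < e ->
  (c%:E <= lebesgue_measure (vol_nbhd A e))%E.
Proof.
move=> c00; have [k0 [M [M0 HM]]] := discrete_det_energy c00.
exists (c0 ^+ 2 / M); first by rewrite divr_gt0// exprn_gt0.
move=> A Ac cA e e0.
pose K := Num.truncn e^-1.
have Ke : scale R (3 * K) < e.
  rewrite /scale invf_plt ?posrE ?exprn_gt0//; apply: lt_le_trans (truncnS_gt _) _.
  rewrite -natrX ler_nat; apply: (@leq_trans (32 ^ K)); first exact: ltn_expl.
  by rewrite leq_exp2l// leq_pmull.
have [k [w [x [w0 xA wT wF]]]] := frostman (cell_weight_gt0 R) (@cube_cell0 R)
  (@cube_cell_refine R) (@cube_cellL R) (4 * K + k0) A.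
have xc i : unit_cube (x i) by exact/Ac/xA.
have w1 : \sum_i w i <= 1.
  rewrite wT; have := @content_cell _ _ _ (@cube_cell R) _ (cell_weight_gt0 R) A (0%N, (0, 0, 0)%N).
  by rewrite expr0; apply => y _ /=; rewrite cube_cell0.
have ball i n : (n <= 4 * K + k0)%N -> \sum_(i' | coords_close (fun i => x i 0 0)
    (fun i => x i 1 0) (fun i => x i 2 0) (scale R n) i i') w i' <= 27 / (2 ^+ 13) ^+ n.
  by move=> nK; apply: cube_ball => // t; exact: wF.
have cw : c0 <= \sum_i w i by rewrite wT.
have [i1 [i2 H]] := HM K _ _ _ _ w (fun i => xc i 0) (fun i => xc i 1) (fun i => xc i 2)
  w0 w1 cw ball.
apply: le_trans (occupied_cells (scale_gt0 R (3 * K)) c00 M0 w0 cw H) _.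
apply: le_outer_measure => y [i _].
rewrite /grid_cell/= in_itv/= => /andP[y1 y2].
exists (fun j : 'I_3 => if j == 0 then x i1 else if j == 1 then x i2 else x i).
  by move=> j; case: ifP => _; [|case: ifP => _]; exact: xA.
rewrite volE/=.
set D := det3 _ _ _ i1 i2 i in y1 y2.
rewrite -[X in _ - X]/D; apply: le_lt_trans Ke.
have /andP[f1 f2] := floor_itv (D / scale R (3 * K)).
rewrite ler_pdivlMr ?scale_gt0// in f1; rewrite ltr_pdivrMr ?scale_gt0// in f2.
clearbody D; rewrite intrD mulrDl mul1r in y2 f2.
set F := _%:~R * _ in y1 y2 f1 f2; clearbody F.
by rewrite ler_norml; apply/andP; split; lra.
Qed.

End Volume.

(** * Passage to the limit *)

Section UltraLimits.

Lemma ultra_nat (T : Type) (G : set_system T) (s : T -> nat) b :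
  UltraFilter G -> G [set n | (s n <= b)%N] -> exists v, G [set n | s n = v].
Proof.
move=> UG; elim: b => [|b IH] Gb.
  by exists 0%N; apply: filterS Gb => n /=; rewrite leqn0 => /eqP.
have [|Gn] := in_ultra_setVsetC [set n | (s n <= b)%N] UG; first exact: IH.
exists b.+1; apply: filterS (filterI Gb Gn) => n [/= h1 /negP]; rewrite -ltnNge => h2.
by apply/eqP; rewrite eqn_leq h1.
Qed.

(** An ultrafilter contains the inverse image of each neighbourhood of a cluster
    point of the values. *)
Lemma ultra_segment (R : realType) (T : Type) (G : set_system T) (u : T -> R) a b :
  UltraFilter G -> (forall n, a <= u n <= b) -> exists t : R, u @ G --> t.
Proof.
move=> UG ub.
have FG : ProperFilter G by exact: ultra_proper.
have Gu : (u @ G) `[a, b]%classic.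
  by apply: (@filterS _ G _ setT); [move=> n _ /=; rewrite in_itv/=; exact: ub|exact: filterT].
have [t [_ ct]] := segment_compact (fmap_proper_filter u FG) Gu.
exists t => N Nt.
have [//|Gn] := in_ultra_setVsetC (u @^-1` N) UG.
by have [z [/= nz Nz]] := ct (~` N) N Gn Nt.
Qed.

End UltraLimits.

Section Main.
Variable R : realType.
Notation V := 'cV[R]_3.
Notation cc := (cell_content (@cube_cell R) (cell_weight R)).

(** The code is bounded at its first [size s] entries only. *)
Definition bounded_part (C : V -> (nat -> nat) -> Prop) (s : seq nat) : set V :=
  [set x | exists2 sigma, (forall i, (i < size s)%N -> (sigma i <= nth 0%N s i)%N) & C x sigma].

(** The bounded parts increase with the bound [m] on the next entry and exhaust the
    given part. *)
Lemma bounded_part_step C s (c : R) : c < cc (bounded_part C s) ->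
  exists m, c < cc (bounded_part C (rcons s m)).
Proof.
move=> cs; apply: contrapT => /forallNP H.
move: cs; rewrite ltNge => /negP; apply.
have -> : bounded_part C s = \bigcup_m bounded_part C (rcons s m).
  apply/seteqP; split=> [x [sigma sb Cx]|x [m _ [sigma sb Cx]]].
    exists (sigma (size s)) => //; exists sigma => // i.
    rewrite size_rcons ltnS nth_rcons; case: ltngtP => // [h _|-> _//]; exact: sb.
  exists sigma => // i si; have := sb i; rewrite size_rcons nth_rcons si; apply.
  exact: ltnW.
apply: (content_increasing (cell_weight_gt0 R) (cell_weight_le1 R) (@cube_cell0 R) (@cube_cell_refine R)).
  move=> m x [sigma sb Cx]; exists sigma => // i; have := sb i.
  rewrite !size_rcons !nth_rcons; case: ifP => // _; case: ifP => // _ h /h.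
  by move=> /leq_trans; apply.
by move=> m; rewrite leNgt; exact/negP/H.
Qed.

Lemma vol_bound (x : 'I_3 -> V) : (forall j, unit_cube (x j)) -> `|vol x| <= 3.
Proof.
move=> xc; rewrite volE.
have P (a b c d e : R) : 0 <= a <= 1 -> 0 <= b <= 1 -> 0 <= c <= 1 -> 0 <= d <= 1 ->
    0 <= e <= 1 -> -1 <= a * (b * c - d * e) <= 1.
  move=> /andP[? ?] /andP[? ?] /andP[? ?] /andP[? ?] /andP[? ?].
  have /andP[? ?] : 0 <= b * c <= 1 by rewrite mulr_ge0// mulr_ile1.
  have /andP[? ?] : 0 <= d * e <= 1 by rewrite mulr_ge0// mulr_ile1.
  by apply/andP; split; nra.
have /andP[? ?] := P _ _ _ _ _ (xc 0 0) (xc 1 1) (xc 2 2) (xc 1 2) (xc 2 1).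
have /andP[? ?] := P _ _ _ _ _ (xc 1 0) (xc 0 1) (xc 2 2) (xc 0 2) (xc 2 1).
have /andP[? ?] := P _ _ _ _ _ (xc 2 0) (xc 0 1) (xc 1 2) (xc 0 2) (xc 1 1).
by rewrite ler_norml; apply/andP; split; lra.
Qed.

Lemma open_vol_nbhd (A : set V) (e : R) : open (vol_nbhd A e).
Proof.
have -> : vol_nbhd A e = \bigcup_(x in [set x | forall j, A (x j)]) ball (vol x) e.
  by apply/seteqP; split=> y [x Ax]; rewrite -?ball_normE/= => h; exists x => //;
    rewrite -?ball_normE/= distrC.
by apply: bigcup_open => x _; exact: ball_open.
Qed.

(** Take triples of points of the bounded parts, with their codes, whose volumes
    approach [y].  Along an ultrafilter the points converge in the cube, and each
    entry of the codes, being bounded, is eventually constant.  The limits satisfy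
    [C] because [C] is closed. *)
Lemma vol_nbhd_limit (C : V -> (nat -> nat) -> Prop) (s : nat -> seq nat) (b : nat -> nat) :
  closed_code C -> (forall n, size (s n) = n) -> (forall n i, (i < n)%N -> nth 0%N (s n) i = b i) ->
  (forall x sigma, C x sigma -> unit_cube x) ->
  \bigcap_n vol_nbhd (bounded_part C (s n)) n.+1%:R^-1 `<=`
    volume_set [set x | exists sigma, C x sigma].
Proof.
move=> Ccl ss sb Cc y Oy.
have /choice[x xP] : forall n, exists x : 'I_3 -> V,
    (forall j, bounded_part C (s n) (x j)) /\ `|y - vol x| < n.+1%:R^-1.
  by move=> n; have [x ? ?] := Oy n I; exists x.
have /choice[sg sgP] : forall n, exists sg : 'I_3 -> nat -> nat, forall j,
    (forall i, (i < n)%N -> (sg j i <= b i)%N) /\ C (x n j) (sg j).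
  move=> n; have /choice[sg sgP] : forall j, exists sg : nat -> nat,
      (forall i, (i < n)%N -> (sg i <= b i)%N) /\ C (x n j) sg.
    move=> j; have [sg sgb Csg] := (xP n).1 j; exists sg; split=> // i ni.
    by rewrite -(sb n i ni); apply: sgb; rewrite ss.
  by exists sg.
have [G [UG ooG]] := @ultraFilterLemma _ (\oo : set_system nat) _.
have PG : ProperFilter G by exact: ultra_proper.
have late i : G [set n | (i < n)%N].
  by apply: ooG; exists i.+1.
have xcube n j : unit_cube (x n j) by exact: Cc ((sgP n j).2).
have /choice[t tP] : forall ji : 'I_3 * 'I_3, exists t : R,
    (fun n => x n ji.1 ji.2 0) @ G --> t.
  by move=> [j i]; apply: (@ultra_segment _ _ _ _ 0 1) => // n; exact: xcube.
have /choice[v vP] : forall ji : 'I_3 * nat, exists v, G [set n | sg n ji.1 ji.2 = v].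
  move=> [j i]; apply: (@ultra_nat _ _ _ (b i)).
  by apply: filterS (late i) => n /= ni; exact: (sgP n j).1.
pose xl (j : 'I_3) : V := \col_i t (j, i).
have xlE j i : xl j i 0 = t (j, i) by rewrite mxE.
have xlC j : C (xl j) (fun i => v (j, i)).
  apply: Ccl => N U /nbhs_ballP[e /= e0 eU].
  have G1 : G [set n | forall i, `|xl j i 0 - x n j i 0| < e].
    apply: (@filter_forall _ _ (fun i n => `|xl j i 0 - x n j i 0| < e)) => i.
    have /cvgrPdist_lt/(_ e e0) := tP (j, i).
    by rewrite xlE.
  have G2 : G [set n | forall i : 'I_N, sg n j i = v (j, val i)].
    apply: (@filter_forall _ _ (fun (i : 'I_N) n => sg n j i = v (j, val i))) => i.
    exact: (vP (j, val i)).
  have [n [h1 h2]] := filter_ex (filterI G1 G2).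
  exists (x n j), (sg n j); split.
  - apply: eU; split=> // i k; rewrite (ord1 k); exact: h1.
  - by move=> i iN; exact: (h2 (Ordinal iN)).
  - exact: (sgP n j).2.
exists xl => [j|]; first by exists (fun i => v (j, i)).
rewrite -/(vol xl).
have c1 : (fun n => vol (x n)) @ G --> vol xl.
  have cx j i : (fun n => x n j i 0) @ G --> xl j i 0 by rewrite xlE; exact: (tP (j, i)).
  rewrite volE; under eq_fun do rewrite volE.
  by apply: cvgD; [apply: cvgB|]; apply: cvgM => //; apply: cvgB; apply: cvgM.
have c2 : (fun n => vol (x n)) @ G --> y.
  apply/cvgrPdist_lt => e e0.
  apply: filterS (late (Num.truncn e^-1)) => n /= ne.
  apply: lt_trans (xP n).2 _; rewrite invf_plt ?posrE//.
  by apply: lt_trans (truncnS_gt _) _; rewrite ltr_nat ltnS.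
exact: (cvg_unique _ c1 c2).
Qed.

End Main.

(* [lebesgue_measure] is an outer measure on all subsets of R; it coincides with
   Lebesgue measure on Lebesgue measurable sets, in particular on the analytic
   set [volume_set E]. *)
Theorem theorem1p2 (R : realType) (E : set 'cV[R]_3)
    (E_borel : borel_set E)
    (E_cube : E `<=` @unit_cube R 3)
    (E_dim : ((13 / 5)%:E < hausdorff_dim E)%E) :
  (0 < lebesgue_measure (volume_set E))%E.
Proof.
have E_content := hausdorff_content E_cube E_dim.
have [C Ccl EC] := borel_suslin E_borel.
set c1 := cell_content _ _ E in E_content.
have c10 : 0 < c1 / 2 by rewrite divr_gt0.
have [c c0 Hc] := volume_neighbourhood c10.
pose P := bounded_part C.
have /choice[f fP] : forall s, exists m, c1 / 2 < cell_content (@cube_cell R) (cell_weight R) (P s) ->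
    c1 / 2 < cell_content (@cube_cell R) (cell_weight R) (P (rcons s m)).
  move=> s; have [h|h] := pselect (c1 / 2 < cell_content (@cube_cell R) (cell_weight R) (P s)).
    by have [m ?] := bounded_part_step h; exists m.
  by exists 0%N.
pose s n := iter n (fun l => rcons l (f l)) [::].
have P0 : P [::] = E.
  by rewrite EC; apply/seteqP; split=> [x [sg _ ?]|x [sg ?]]; exists sg.
have sP n : c1 / 2 < cell_content (@cube_cell R) (cell_weight R) (P (s n)).
  elim: n => [|n IH]; last exact: fP.
  by rewrite /s/= P0 -/c1 gtr_pMr// invf_lt1// ltr1n.
have ss n : size (s n) = n.
  by elim: n => // n IH; rewrite /s iterS size_rcons -/(s n) IH.
have sb n i : (i < n)%N -> nth 0%N (s n) i = f (s i).
  elim: n => // n IH; rewrite ltnS leq_eqVlt => /predU1P[->|ni].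
    by rewrite /s iterS nth_rcons -/(s n) ss ltnn eqxx.
  by rewrite /s iterS nth_rcons -/(s n) ss ni IH.
have PE l : P l `<=` E by move=> x [sg _ Cx]; rewrite EC; exists sg.
have Ccube x sg : C x sg -> unit_cube x by move=> Cx; apply: E_cube; rewrite EC; exists sg.
pose O n := vol_nbhd (P (s n)) n.+1%:R^-1.
have O_open n : open (O n) by exact: open_vol_nbhd.
have O_meas n : measurable (O n : set (measurableTypeR R)) by exact: open_measurable.
have O_ge n : (c%:E <= lebesgue_measure (O n))%E.
  apply: Hc; [exact: subset_trans (PE _) E_cube|exact/ltW/sP|].
  by rewrite invr_gt0.
have O_dec : nonincreasing_seq O.
  apply/nonincreasing_seqP => n; apply/subsetPset => y [x xP yx].
  exists x => [j|].
    have [sg sgb Cx] := xP j; exists sg => // i; rewrite ss => ni.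
    have := sgb i; rewrite ss (sb n.+1 i) ?(sb n i)//; last exact: ltnW.
    by apply; exact: ltnW.
  apply: lt_le_trans yx _; rewrite lef_pV2 ?posrE// ler_nat.
  by rewrite ltnS.
have O_fin : (lebesgue_measure (O 0%N) < +oo)%E.
  apply: (@le_lt_trans _ _ (lebesgue_measure (`[-4, 4]%classic : set R))).
    apply: le_outer_measure => y [x xP yx] /=; rewrite in_itv/=.
    have := vol_bound (fun j => E_cube _ (PE _ _ (xP j))).
    move: yx; rewrite invr1 ler_norml ltr_norml => /andP[? ?] /andP[? ?].
    by apply/andP; split; lra.
  by rewrite lebesgue_measure_itv/= lte_fin; case: ifP => _; rewrite ?ltry// -EFinD ltry.
have capm : measurable (\bigcap_n O n : set (measurableTypeR R)).
  exact: bigcap_measurable.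
have cvO := nonincreasing_cvg_mu O_fin O_meas capm O_dec.
have capE : \bigcap_n O n `<=` volume_set E.
  by rewrite EC; apply: (vol_nbhd_limit (b := fun i => f (s i)) Ccl ss sb Ccube).
apply: (@lt_le_trans _ _ c%:E); first by rewrite lte_fin.
apply: (@le_trans _ _ (lebesgue_measure (\bigcap_n O n))); last exact: le_outer_measure.
rewrite -(cvg_lim _ cvO)//; apply: lime_ge; first by apply/cvg_ex; eexists; exact: cvO.
by apply: nearW => n; exact: O_ge.
Qed.
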